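(* Every non-reflexive Banach space over $\mathbb{K}$ admits an equivalent norm for which it fails the FR-property.
   Context: $\mathbb{K}$ is $\mathbb{R}$ or $\mathbb{C}$. For a Banach space $Y$, $S_Y$ is its unit sphere and $Y^*$ its dual; for $u\in S_Y$, $D(Y,u)=\{y^*\in Y^* : \|y^*\|=y^*(u)=1\}$. Let $X$ be a closed subspace of $Y$ with inclusion $J:X\to Y$ (a linear isometry). Put $\Pi(X,Y)=\{(x,y^* )\in S_X\times S_{Y^*} : y^*\in D(Y,Jx)\}$. Let $B(S_X,Y)$ be the Banach space of all bounded functions from $S_X$ to $Y$ with the supremum norm. For $f\in B(S_X,Y)$, the spatial numerical range is $W(f)=\{y^*(f(x)) : (x,y^* )\in\Pi(X,Y)\}$ and the intrinsic numerical range is $V(f)=\{\Phi(f) : \Phi\in D(B(S_X,Y),J|_{S_X})\}$. A bounded linear operator $T:X\to Y$ is identified with $T|_{S_X}\in B(S_X,Y)$; $L(X,Y)$ is the space of bounded linear operators from $X$ to $Y$; $\overline{\mathrm{co}}$ denotes closed convex hull. A Banach space $Y$ has the FR-property if for every closed subspace $X$ of $Y$ and every $T\in L(X,Y)$, the equality $\overline{\mathrm{co}}\,W(T)=V(T)$ holds. *)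

(* Defs.v *)
From Stdlib Require Import Reals Lra FunctionalExtensionality ProofIrrelevance.
From Coquelicot Require Import Coquelicot.
Open Scope R_scope.

Set Implicit Arguments.
Unset Strict Implicit.

Inductive real_or_complex : Set := RealField | ComplexField.

Definition scalars (k : real_or_complex) : AbsRing :=
  match k with RealField => R_AbsRing | ComplexField => C_AbsRing end.

Definition of_real (k : real_or_complex) : R -> scalars k :=
  match k return R -> scalars k with
  | RealField => fun t => t
  | ComplexField => RtoC
  end.

Lemma scalars_mult_comm (k : real_or_complex) (a b : scalars k) :
  mult a b = mult b a.
Proof. destruct k; [exact (Rmult_comm a b) | exact (Cmult_comm a b)]. Qed.

Lemma scalars_inv (k : real_or_complex) (a : scalars k) :
  a <> zero -> exists b, mult b a = one /\ abs b * abs a = 1.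
Proof.
destruct k; intros Ha; simpl in a, Ha.
- change (a <> 0) in Ha. exists (/ a). split.
  + exact (Rinv_l a Ha).
  + change (Rabs (/ a) * Rabs a = 1).
    rewrite <- Rabs_mult, Rinv_l by exact Ha. exact Rabs_R1.
- change (a <> RtoC 0) in Ha. exists (Cinv a). split.
  + exact (Cinv_l a Ha).
  + change (Cmod (Cinv a) * Cmod a = 1).
    rewrite <- Cmod_mult, Cinv_l by exact Ha. exact Cmod_1.
Qed.

Record is_norm (K : AbsRing) (E : ModuleSpace K) (N : E -> R) : Prop := {
  is_norm_triangle : forall x y, N (plus x y) <= N x + N y;
  is_norm_scal : forall a x, N (scal a x) = abs a * N x;
  is_norm_eq_zero : forall x, N x = 0 -> x = zero
}.

Section NormedModuleOfNorm.

Context {K : AbsRing} {E : ModuleSpace K} {N : E -> R} (HN : is_norm N).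

Definition norm_ball (x : E) (e : R) (y : E) : Prop := N (minus y x) < e.

Lemma is_norm_zero : N zero = 0.
Proof.
generalize (is_norm_scal HN (zero : K) zero).
rewrite (abs_zero : abs (zero : K) = 0).
rewrite (scal_zero_l zero : scal (zero : K) (zero : E) = zero). lra.
Qed.

Lemma is_norm_opp (x : E) : N (opp x) = N x.
Proof.
generalize (is_norm_scal HN (opp one : K) x).
rewrite (abs_opp_one : abs (opp one : K) = 1).
rewrite (scal_opp_one x : scal (opp one : K) x = opp x). lra.
Qed.

Lemma norm_ball_center (x : E) (e : posreal) : norm_ball x e x.
Proof.
unfold norm_ball. rewrite minus_eq_zero.
apply Rle_lt_trans with 0; [right; exact is_norm_zero | apply cond_pos].
Qed.

Lemma norm_ball_sym (x y : E) (e : R) : norm_ball x e y -> norm_ball y e x.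
Proof.
unfold norm_ball. rewrite <- (is_norm_opp (minus y x)), (opp_minus y x). auto.
Qed.

Lemma norm_ball_triangle (x y z : E) (e1 e2 : R) :
  norm_ball x e1 y -> norm_ball y e2 z -> norm_ball x (e1 + e2) z.
Proof.
unfold norm_ball. intros H1 H2. rewrite (minus_trans y z x).
apply Rle_lt_trans with (N (minus z y) + N (minus y x)); [|lra].
exact (is_norm_triangle HN (minus z y) (minus y x)).
Qed.

Definition norm_UniformSpace_mixin : UniformSpace.mixin_of E :=
  UniformSpace.Mixin E zero norm_ball
    norm_ball_center norm_ball_sym norm_ball_triangle.

Definition NormedModuleAux_of_norm : NormedModuleAux K :=
  NormedModuleAux.Pack K E
    (NormedModuleAux.Class K E (ModuleSpace.class K E) norm_UniformSpace_mixin)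
    E.

Lemma norm_of_norm_compat2 (x y : NormedModuleAux_of_norm) (e : posreal) :
  ball x e y -> N (minus y x) < 1 * e.
Proof. rewrite Rmult_1_l. exact (fun h => h). Qed.

Lemma norm_of_norm_scal (a : K) (x : NormedModuleAux_of_norm) :
  N (scal a x) <= abs a * N x.
Proof. right. exact (is_norm_scal HN a x). Qed.

Definition NormedModule_of_norm : NormedModule K :=
  NormedModule.Pack K E
    (NormedModule.Class K E (NormedModuleAux.class K NormedModuleAux_of_norm)
      (NormedModule.Mixin K NormedModuleAux_of_norm N 1
        (is_norm_triangle HN) norm_of_norm_scal
        (fun x y e (h : N (minus y x) < e) => h)
        norm_of_norm_compat2 (is_norm_eq_zero HN)))
    E.

End NormedModuleOfNorm.

(* [NormedModule] only asks for an inequality in the homogeneity axiom; over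
   R or C this is the same as equality. *)
Lemma is_norm_of_le (k : real_or_complex) (E : ModuleSpace (scalars k))
    (N : E -> R) :
  (forall x y, N (plus x y) <= N x + N y) ->
  (forall a x, N (scal a x) <= abs a * N x) ->
  (forall x, N x = 0 -> x = zero) ->
  is_norm N.
Proof.
intros Ht Hs Hz.
assert (H0 : N zero <= 0).
{ generalize (Hs (zero : scalars k) zero).
  rewrite (abs_zero : abs (zero : scalars k) = 0).
  rewrite (scal_zero_l zero : scal (zero : scalars k) (zero : E) = zero).
  lra. }
assert (Hpos : forall x, 0 <= N x).
{ intros x. generalize (Ht x (opp x)) (Hs (opp one : scalars k) x) (Ht zero zero).
  rewrite (plus_zero_l zero : plus (zero : E) zero = zero).
  rewrite (abs_opp_one : abs (opp one : scalars k) = 1).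
  rewrite (scal_opp_one x : scal (opp one : scalars k) x = opp x).
  rewrite (plus_opp_r x : plus x (opp x) = zero). lra. }
split; auto.
intros a x. apply Rle_antisym; [apply Hs|].
destruct (Req_dec (abs a) 0) as [Ha|Ha].
- rewrite Ha, Rmult_0_l. apply Hpos.
- destruct (@scalars_inv k a) as [b [Hb1 Hb2]].
  { intros E0. apply Ha. rewrite E0. apply abs_zero. }
  generalize (Hs b (scal a x)). rewrite scal_assoc, Hb1, scal_one. intros H.
  apply Rle_trans with (abs a * (abs b * N (scal a x))).
  + apply Rmult_le_compat_l; [apply abs_ge_0 | exact H].
  + right. rewrite <- Rmult_assoc, (Rmult_comm (abs a)), Hb2. ring.
Qed.

Lemma is_norm_norm (k : real_or_complex) (E : NormedModule (scalars k)) :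
  is_norm (norm : E -> R).
Proof.
apply is_norm_of_le; [exact norm_triangle | exact norm_scal | exact norm_eq_zero].
Qed.

Record is_submodule (K : AbsRing) (E : ModuleSpace K) (P : E -> Prop) : Prop := {
  submodule_zero : P zero;
  submodule_plus : forall x y, P x -> P y -> P (plus x y);
  submodule_scal : forall a x, P x -> P (scal a x)
}.

Section SubModuleSpace.

Context {K : AbsRing} {E : ModuleSpace K} {P : E -> Prop}.
Context (HP : is_submodule P).

Lemma submodule_opp (x : E) : P x -> P (opp x).
Proof. intros H. rewrite <- scal_opp_one. apply (submodule_scal HP), H. Qed.

Lemma sig_eq (T : Type) (Q : T -> Prop) (x y : sig Q) :
  proj1_sig x = proj1_sig y -> x = y.
Proof. apply eq_sig_hprop. intros t. apply proof_irrelevance. Qed.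

Definition sub_zero : sig P := exist P zero (submodule_zero HP).
Definition sub_plus (x y : sig P) : sig P :=
  exist P (plus (proj1_sig x) (proj1_sig y))
    (submodule_plus HP (proj2_sig x) (proj2_sig y)).
Definition sub_opp (x : sig P) : sig P :=
  exist P (opp (proj1_sig x)) (submodule_opp (proj2_sig x)).
Definition sub_scal (a : K) (x : sig P) : sig P :=
  exist P (scal a (proj1_sig x)) (submodule_scal HP a (proj2_sig x)).

Lemma sub_plus_comm x y : sub_plus x y = sub_plus y x.
Proof. apply sig_eq. exact (plus_comm (proj1_sig x) (proj1_sig y)). Qed.
Lemma sub_plus_assoc x y z :
  sub_plus x (sub_plus y z) = sub_plus (sub_plus x y) z.
Proof. apply sig_eq. exact (plus_assoc (proj1_sig x) (proj1_sig y) (proj1_sig z)). Qed.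
Lemma sub_plus_zero_r x : sub_plus x sub_zero = x.
Proof. apply sig_eq. exact (plus_zero_r (proj1_sig x)). Qed.
Lemma sub_plus_opp_r x : sub_plus x (sub_opp x) = sub_zero.
Proof. apply sig_eq. exact (plus_opp_r (proj1_sig x)). Qed.

Definition sub_AbelianMonoid_mixin : AbelianMonoid.mixin_of (sig P) :=
  AbelianMonoid.Mixin (sig P) sub_plus sub_zero
    sub_plus_comm sub_plus_assoc sub_plus_zero_r.

Definition sub_AbelianMonoid : AbelianMonoid :=
  AbelianMonoid.Pack (sig P) sub_AbelianMonoid_mixin (sig P).

Definition sub_AbelianGroup_class : AbelianGroup.class_of (sig P) :=
  AbelianGroup.Class (sig P) sub_AbelianMonoid_mixin
    (AbelianGroup.Mixin sub_AbelianMonoid sub_opp sub_plus_opp_r).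

Definition sub_AbelianGroup : AbelianGroup :=
  AbelianGroup.Pack (sig P) sub_AbelianGroup_class (sig P).

Lemma sub_scal_assoc a b x : sub_scal a (sub_scal b x) = sub_scal (mult a b) x.
Proof. apply sig_eq. exact (scal_assoc a b (proj1_sig x)). Qed.
Lemma sub_scal_one x : sub_scal one x = x.
Proof. apply sig_eq. exact (scal_one (proj1_sig x)). Qed.
Lemma sub_scal_distr_l a x y :
  sub_scal a (sub_plus x y) = sub_plus (sub_scal a x) (sub_scal a y).
Proof. apply sig_eq. exact (scal_distr_l a (proj1_sig x) (proj1_sig y)). Qed.
Lemma sub_scal_distr_r a b x :
  sub_scal (plus a b) x = sub_plus (sub_scal a x) (sub_scal b x).
Proof. apply sig_eq. exact (scal_distr_r a b (proj1_sig x)). Qed.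

Definition sub_ModuleSpace_mixin : ModuleSpace.mixin_of K sub_AbelianGroup :=
  ModuleSpace.Mixin K sub_AbelianGroup sub_scal
    sub_scal_assoc sub_scal_one sub_scal_distr_l sub_scal_distr_r.

Definition sub_ModuleSpace : ModuleSpace K :=
  ModuleSpace.Pack K (sig P)
    (ModuleSpace.Class K (sig P) sub_AbelianGroup_class sub_ModuleSpace_mixin)
    (sig P).

End SubModuleSpace.

Section FunModuleSpace.

Context {K : AbsRing} (S : Type) (E : ModuleSpace K).

Definition fun_plus (f g : S -> E) : S -> E := fun s => plus (f s) (g s).
Definition fun_opp (f : S -> E) : S -> E := fun s => opp (f s).
Definition fun_zero : S -> E := fun _ => zero.
Definition fun_scal (a : K) (f : S -> E) : S -> E := fun s => scal a (f s).

Lemma fun_plus_comm f g : fun_plus f g = fun_plus g f.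
Proof. apply functional_extensionality. intros s. exact (plus_comm (f s) (g s)). Qed.
Lemma fun_plus_assoc f g h :
  fun_plus f (fun_plus g h) = fun_plus (fun_plus f g) h.
Proof. apply functional_extensionality. intros s. exact (plus_assoc (f s) (g s) (h s)). Qed.
Lemma fun_plus_zero_r f : fun_plus f fun_zero = f.
Proof. apply functional_extensionality. intros s. exact (plus_zero_r (f s)). Qed.
Lemma fun_plus_opp_r f : fun_plus f (fun_opp f) = fun_zero.
Proof. apply functional_extensionality. intros s. exact (plus_opp_r (f s)). Qed.

Definition fun_AbelianMonoid_mixin : AbelianMonoid.mixin_of (S -> E) :=
  AbelianMonoid.Mixin (S -> E) fun_plus fun_zero
    fun_plus_comm fun_plus_assoc fun_plus_zero_r.

Definition fun_AbelianMonoid : AbelianMonoid :=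
  AbelianMonoid.Pack (S -> E) fun_AbelianMonoid_mixin (S -> E).

Definition fun_AbelianGroup_class : AbelianGroup.class_of (S -> E) :=
  AbelianGroup.Class (S -> E) fun_AbelianMonoid_mixin
    (AbelianGroup.Mixin fun_AbelianMonoid fun_opp fun_plus_opp_r).

Definition fun_AbelianGroup : AbelianGroup :=
  AbelianGroup.Pack (S -> E) fun_AbelianGroup_class (S -> E).

Lemma fun_scal_assoc a b f : fun_scal a (fun_scal b f) = fun_scal (mult a b) f.
Proof. apply functional_extensionality. intros s. exact (scal_assoc a b (f s)). Qed.
Lemma fun_scal_one f : fun_scal one f = f.
Proof. apply functional_extensionality. intros s. exact (scal_one (f s)). Qed.
Lemma fun_scal_distr_l a f g :
  fun_scal a (fun_plus f g) = fun_plus (fun_scal a f) (fun_scal a g).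
Proof. apply functional_extensionality. intros s. exact (scal_distr_l a (f s) (g s)). Qed.
Lemma fun_scal_distr_r a b f :
  fun_scal (plus a b) f = fun_plus (fun_scal a f) (fun_scal b f).
Proof. apply functional_extensionality. intros s. exact (scal_distr_r a b (f s)). Qed.

Definition fun_ModuleSpace_mixin : ModuleSpace.mixin_of K fun_AbelianGroup :=
  ModuleSpace.Mixin K fun_AbelianGroup fun_scal
    fun_scal_assoc fun_scal_one fun_scal_distr_l fun_scal_distr_r.

Definition fun_ModuleSpace : ModuleSpace K :=
  ModuleSpace.Pack K (S -> E)
    (ModuleSpace.Class K (S -> E) fun_AbelianGroup_class fun_ModuleSpace_mixin)
    (S -> E).

End FunModuleSpace.

(* Only used for bounded sets of nonnegative reals; [Lub_Rbar] sends the empty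
   set to [m_infty], so its supremum here is 0. *)
Definition sup (A : R -> Prop) : R := real (Lub_Rbar A).

Lemma sup_ub (A : R -> Prop) (M r : R) :
  (forall s, A s -> s <= M) -> A r -> r <= sup A.
Proof.
intros HM Hr. unfold sup.
destruct (Lub_Rbar_correct A) as [H1 H2].
specialize (H1 r Hr). specialize (H2 (Finite M) HM).
destruct (Lub_Rbar A); simpl in *; tauto.
Qed.

Lemma sup_le (A : R -> Prop) (M : R) :
  0 <= M -> (forall s, A s -> s <= M) -> sup A <= M.
Proof.
intros H0 HM. unfold sup.
destruct (Lub_Rbar_correct A) as [H1 H2].
specialize (H2 (Finite M) HM).
destruct (Lub_Rbar A); simpl in *; tauto.
Qed.

Lemma sup_ge_0 (A : R -> Prop) : (forall s, A s -> 0 <= s) -> 0 <= sup A.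
Proof.
intros Hp. unfold sup.
destruct (Lub_Rbar_correct A) as [H1 H2].
destruct (Lub_Rbar A) as [r| |]; simpl; try lra.
apply Rnot_lt_le. intros Hr.
apply (H2 m_infty). intros s Hs.
specialize (Hp s Hs). specialize (H1 s Hs). simpl in H1. lra.
Qed.

Section BoundedFunctions.

Context {k : real_or_complex} (S : Type) (Y : NormedModule (scalars k)).

Definition is_bounded (f : fun_ModuleSpace S Y) : Prop :=
  exists M, forall s, norm (f s) <= M.

Lemma is_bounded_submodule : is_submodule is_bounded.
Proof.
split.
- exists 0. intros s. change (norm (zero : Y) <= 0). rewrite norm_zero. lra.
- intros f g [M HM] [M' HM']. exists (M + M'). intros s.
  eapply Rle_trans; [apply (norm_triangle (f s) (g s))|].
  specialize (HM s). specialize (HM' s). lra.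
- intros a f [M HM]. exists (abs a * M). intros s.
  eapply Rle_trans; [apply (norm_scal a (f s))|].
  apply Rmult_le_compat_l; [apply abs_ge_0 | apply HM].
Qed.

Definition sup_norm (f : sub_ModuleSpace is_bounded_submodule) : R :=
  sup (fun r => exists s, r = norm (proj1_sig f s)).

Lemma sup_norm_ub f s : norm (proj1_sig f s) <= sup_norm f.
Proof.
destruct f as [f [M HM]]. unfold sup_norm; simpl. apply sup_ub with M.
- intros r [t ->]. apply HM.
- exists s. reflexivity.
Qed.

Lemma sup_norm_le f M :
  0 <= M -> (forall s, norm (proj1_sig f s) <= M) -> sup_norm f <= M.
Proof. intros H0 HM. apply sup_le; auto. intros r [s ->]. apply HM. Qed.

Lemma sup_norm_ge_0 f : 0 <= sup_norm f.
Proof. apply sup_ge_0. intros r [s ->]. apply norm_ge_0. Qed.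

Lemma sup_norm_is_norm : is_norm sup_norm.
Proof.
apply is_norm_of_le.
- intros f g. apply sup_norm_le.
  + generalize (sup_norm_ge_0 f) (sup_norm_ge_0 g). lra.
  + intros s.
    apply Rle_trans with (norm (proj1_sig f s) + norm (proj1_sig g s));
      [exact (norm_triangle (proj1_sig f s) (proj1_sig g s))|].
    apply Rplus_le_compat; apply sup_norm_ub.
- intros a f. apply sup_norm_le.
  + apply Rmult_le_pos; [apply abs_ge_0 | apply sup_norm_ge_0].
  + intros s. eapply Rle_trans; [exact (norm_scal a (proj1_sig f s))|].
    apply Rmult_le_compat_l; [apply abs_ge_0 | apply sup_norm_ub].
- intros f Hf. apply sig_eq, functional_extensionality. intros s.
  apply norm_eq_zero, Rle_antisym; [|apply norm_ge_0].
  rewrite <- Hf. apply sup_norm_ub.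
Qed.

Definition bounded_functions : NormedModule (scalars k) :=
  NormedModule_of_norm sup_norm_is_norm.

End BoundedFunctions.

Section Dual.

Context {k : real_or_complex} (Y : NormedModule (scalars k)).

Notation K := (AbsRing_NormedModule (scalars k)).

(* [is_linear] includes boundedness. *)
Definition is_functional (f : fun_ModuleSpace Y K) : Prop :=
  is_linear (f : Y -> K).

Lemma is_functional_submodule : is_submodule is_functional.
Proof.
split.
- exact is_linear_zero.
- intros f g [Hf1 Hf2 [M [HM Hf3]]] [Hg1 Hg2 [M' [HM' Hg3]]]. split.
  + intros x y. change (plus (f (plus x y)) (g (plus x y))
      = plus (plus (f x) (g x)) (plus (f y) (g y))).
    rewrite Hf1, Hg1, <- !plus_assoc. f_equal.
    rewrite !plus_assoc. f_equal. apply plus_comm.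
  + intros a x. change (plus (f (scal a x)) (g (scal a x))
      = scal a (plus (f x) (g x))).
    rewrite Hf2, Hg2, scal_distr_l. reflexivity.
  + exists (M + M'). split; [lra|]. intros x.
    eapply Rle_trans; [apply (norm_triangle (f x) (g x))|].
    specialize (Hf3 x). specialize (Hg3 x). lra.
- intros a f [Hf1 Hf2 [M [HM Hf3]]]. split.
  + intros x y. change (scal a (f (plus x y)) = plus (scal a (f x)) (scal a (f y))).
    rewrite Hf1. exact (scal_distr_l a (f x) (f y)).
  + intros b x. change (scal a (f (scal b x)) = scal b (scal a (f x))).
    rewrite Hf2. rewrite (scal_assoc a b (f x) :
      scal a (scal b (f x)) = scal (mult a b) (f x)), scalars_mult_comm.
    symmetry. exact (scal_assoc b a (f x)).
  + exists ((abs a + 1) * M). generalize (abs_ge_0 a). intros Ha.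
    split; [apply Rmult_lt_0_compat; lra|]. intros x.
    eapply Rle_trans; [apply (norm_scal a (f x))|].
    rewrite Rmult_assoc. apply Rmult_le_compat; auto using norm_ge_0. lra.
Qed.

Definition dual_norm (f : sub_ModuleSpace is_functional_submodule) : R :=
  sup (fun r => exists y : Y, norm y <= 1 /\ r = norm (proj1_sig f y : K)).

Lemma dual_norm_ub1 f (y : Y) :
  norm y <= 1 -> norm (proj1_sig f y : K) <= dual_norm f.
Proof.
destruct f as [f [H1 H2 [M [HM H3]]]]. intros Hy.
unfold dual_norm; simpl. apply sup_ub with M.
- intros r [z [Hz ->]]. eapply Rle_trans; [apply H3|].
  rewrite <- (Rmult_1_r M) at 2. apply Rmult_le_compat_l; lra.
- exists y. auto.
Qed.

Lemma dual_norm_le f M :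
  0 <= M -> (forall y : Y, norm y <= 1 -> norm (proj1_sig f y : K) <= M) ->
  dual_norm f <= M.
Proof. intros H0 HM. apply sup_le; auto. intros r [y [Hy ->]]. auto. Qed.

Lemma dual_norm_ge_0 f : 0 <= dual_norm f.
Proof. apply sup_ge_0. intros r [s [_ ->]]. apply norm_ge_0. Qed.

Lemma abs_of_real (t : R) : abs (of_real k t) = Rabs t.
Proof. destruct k; [reflexivity | exact (Cmod_R t)]. Qed.

Lemma dual_norm_ub f (y : Y) :
  norm (proj1_sig f y : K) <= dual_norm f * norm y.
Proof.
destruct (Req_dec (norm y) 0) as [Hy|Hy].
- generalize (norm_eq_zero y Hy). intros ->. destruct f as [f Hf]. simpl.
  rewrite (linear_zero f Hf), !norm_zero. lra.
- assert (Hy' : 0 < norm y) by (generalize (norm_ge_0 y); lra).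
  set (a := of_real k (/ norm y)).
  assert (Ha : abs a = / norm y).
  { unfold a. rewrite abs_of_real. apply Rabs_pos_eq.
    left. apply Rinv_0_lt_compat, Hy'. }
  assert (H : norm (scal a y) <= 1).
  { eapply Rle_trans; [apply norm_scal|]. rewrite Ha, Rinv_l; lra. }
  apply (dual_norm_ub1 f) in H. destruct f as [f Hf]. simpl in *.
  rewrite (linear_scal f Hf) in H.
  rewrite (is_norm_scal (is_norm_norm K) a (f y)), Ha in H.
  apply (Rmult_le_compat_l (norm y)) in H; [|lra].
  rewrite <- Rmult_assoc, Rinv_r, Rmult_1_l in H by lra. lra.
Qed.

Lemma dual_norm_is_norm : is_norm dual_norm.
Proof.
apply is_norm_of_le.
- intros f g. apply dual_norm_le.
  + generalize (dual_norm_ge_0 f) (dual_norm_ge_0 g). lra.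
  + intros y Hy.
    apply Rle_trans with (norm (proj1_sig f y : K) + norm (proj1_sig g y : K));
      [exact (norm_triangle (proj1_sig f y : K) (proj1_sig g y))|].
    apply Rplus_le_compat; apply dual_norm_ub1, Hy.
- intros a f. apply dual_norm_le.
  + apply Rmult_le_pos; [apply abs_ge_0 | apply dual_norm_ge_0].
  + intros y Hy. eapply Rle_trans; [exact (norm_scal a (proj1_sig f y : K))|].
    apply Rmult_le_compat_l; [apply abs_ge_0 | apply dual_norm_ub1, Hy].
- intros f Hf. apply sig_eq, functional_extensionality. intros y.
  apply norm_eq_zero, Rle_antisym; [|apply norm_ge_0].
  eapply Rle_trans; [apply dual_norm_ub|]. rewrite Hf. lra.
Qed.

Definition dual : NormedModule (scalars k) :=
  NormedModule_of_norm dual_norm_is_norm.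

Definition dual_app (f : dual) (y : Y) : scalars k := proj1_sig f y.

End Dual.

Section Bidual.

Context {k : real_or_complex} (Y : NormedModule (scalars k)).

Lemma eval_is_functional (y : Y) :
  is_functional (fun f : dual Y => dual_app f y).
Proof.
split.
- reflexivity.
- reflexivity.
- exists (norm y + 1). generalize (norm_ge_0 y). intros Hy. split; [lra|].
  intros f. eapply Rle_trans; [apply (dual_norm_ub f y)|].
  change (norm f * norm y <= (norm y + 1) * norm f).
  generalize (norm_ge_0 f). nra.
Qed.

Definition canonical_embedding (y : Y) : dual (dual Y) :=
  exist _ (fun f : dual Y => dual_app f y) (eval_is_functional y).

Definition reflexive : Prop :=
  forall F : dual (dual Y), exists y : Y, canonical_embedding y = F.

End Bidual.

Record closed_subspace (k : real_or_complex) (Y : NormedModule (scalars k)) := {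
  subspace_set : Y -> Prop;
  subspace_submodule : is_submodule subspace_set;
  subspace_closed : closed subspace_set
}.

Section Subspace.

Context {k : real_or_complex} {Y : NormedModule (scalars k)}.
Context (X : closed_subspace Y).

Lemma subspace_is_norm :
  is_norm (fun x : sub_ModuleSpace (subspace_submodule X) =>
             norm (proj1_sig x)).
Proof.
split.
- intros x y. exact (norm_triangle (proj1_sig x) (proj1_sig y)).
- intros a x. exact (is_norm_scal (is_norm_norm Y) a (proj1_sig x)).
- intros x Hx. apply sig_eq. exact (norm_eq_zero _ Hx).
Qed.

Definition subspace : NormedModule (scalars k) :=
  NormedModule_of_norm subspace_is_norm.

Definition inclusion (x : subspace) : Y := proj1_sig x.

Lemma inclusion_is_linear : is_linear inclusion.
Proof.
split.
- reflexivity.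
- reflexivity.
- exists 1. split; [lra|]. intros x. rewrite Rmult_1_l. apply Rle_refl.
Qed.

End Subspace.

Definition sphere (k : real_or_complex) (E : NormedModule (scalars k)) : Type :=
  {x : E | norm x = 1}.

(* [states u] is the set D(E,u). *)
Definition states (k : real_or_complex) (E : NormedModule (scalars k)) (u : E)
    (f : dual E) : Prop :=
  norm f = 1 /\ dual_app f u = one.

Section NumericalRange.

Context {k : real_or_complex} {Y : NormedModule (scalars k)}.
Context (X : closed_subspace Y).

Definition Pi_set (p : sphere (subspace X) * sphere (dual Y)) : Prop :=
  states (inclusion (proj1_sig (fst p))) (proj1_sig (snd p)).

Definition bounded_on_sphere : NormedModule (scalars k) :=
  bounded_functions (sphere (subspace X)) Y.

Lemma restrict_is_bounded (T : subspace X -> Y) (HT : is_linear T) :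
  is_bounded (fun x : sphere (subspace X) => T (proj1_sig x)).
Proof.
destruct (linear_norm T HT) as [M [_ HM]]. exists M. intros [x Hx]. simpl.
specialize (HM x). rewrite Hx, Rmult_1_r in HM. exact HM.
Qed.

Definition restrict (T : subspace X -> Y) (HT : is_linear T) : bounded_on_sphere :=
  exist _ (fun x : sphere (subspace X) => T (proj1_sig x))
    (restrict_is_bounded HT).

Definition spatial_range (f : bounded_on_sphere) (c : scalars k) : Prop :=
  exists p, Pi_set p /\ c = dual_app (proj1_sig (snd p)) (proj1_sig f (fst p)).

Definition intrinsic_range (f : bounded_on_sphere) (c : scalars k) : Prop :=
  exists Phi : dual bounded_on_sphere,
    states (restrict (inclusion_is_linear X)) Phi /\ c = dual_app Phi f.

End NumericalRange.

Definition convex_set (k : real_or_complex) (A : scalars k -> Prop) : Prop :=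
  forall (a b : scalars k) (t : R), A a -> A b -> 0 <= t <= 1 ->
    A (plus (mult (of_real k t) a) (mult (of_real k (1 - t)) b)).

Definition closed_convex_hull (k : real_or_complex) (A : scalars k -> Prop)
    (c : scalars k) : Prop :=
  forall C : scalars k -> Prop,
    convex_set C -> closed C -> (forall a, A a -> C a) -> C c.

Definition FR_property (k : real_or_complex)
    (Y : CompleteNormedModule (scalars k)) : Prop :=
  forall (X : closed_subspace Y) (T : subspace X -> Y) (HT : is_linear T)
    (c : scalars k),
    closed_convex_hull (spatial_range (restrict HT)) c
    <-> intrinsic_range (restrict HT) c.

Record equivalent_norm (k : real_or_complex)
    (Y : CompleteNormedModule (scalars k)) (N : Y -> R) : Prop := {
  equivalent_norm_is_norm : is_norm N;
  equivalent_norm_bounds : exists a b, 0 < a /\ 0 < b /\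
    forall y, a * norm y <= N y <= b * norm y
}.

Section Renorm.

Context {k : real_or_complex} {Y : CompleteNormedModule (scalars k)}.
Context {N : Y -> R} (HN : equivalent_norm N).

Definition renorm_NormedModule : NormedModule (scalars k) :=
  NormedModule_of_norm (equivalent_norm_is_norm HN).

Lemma renorm_ball_ge (e : posreal) :
  exists d : posreal, forall x y : Y,
    norm_ball (N := N) x d y -> ball x e y.
Proof.
destruct (equivalent_norm_bounds HN) as [a [b [Ha [Hb H]]]].
assert (Hd : 0 < a * e) by (apply Rmult_lt_0_compat; [exact Ha | apply cond_pos]).
exists (mkposreal _ Hd). intros x y Hxy. apply (norm_compat1 (V := Y)).
unfold norm_ball in Hxy; simpl in Hxy. specialize (H (minus y x)).
apply (Rmult_lt_reg_l a); [exact Ha|].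
exact (Rle_lt_trans _ _ _ (proj1 H) Hxy).
Qed.

Lemma renorm_ball_le (e : posreal) :
  exists d : posreal, forall x y : Y,
    ball x d y -> norm_ball (N := N) x e y.
Proof.
destruct (equivalent_norm_bounds HN) as [a [b [Ha [Hb H]]]].
pose proof (norm_factor_gt_0 (V := Y)) as Hf.
assert (Hd : 0 < e / (b * norm_factor (V := Y))).
{ apply Rdiv_lt_0_compat; [apply cond_pos | apply Rmult_lt_0_compat; auto]. }
exists (mkposreal _ Hd). intros x y Hxy. apply (norm_compat2 (V := Y)) in Hxy.
unfold norm_ball. specialize (H (minus y x)). simpl in Hxy.
apply Rle_lt_trans with (b * norm (minus y x)); [apply H|].
apply Rlt_le_trans with
  (b * (norm_factor (V := Y) * (e / (b * norm_factor (V := Y))))).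
- apply Rmult_lt_compat_l; assumption.
- right. field. split; apply Rgt_not_eq; assumption.
Qed.

Lemma renorm_complete (F : (renorm_NormedModule -> Prop) -> Prop) :
  ProperFilter F -> cauchy F ->
  forall e : posreal, F (ball (lim (F : (Y -> Prop) -> Prop) : renorm_NormedModule) e).
Proof.
intros HF HC e. destruct (renorm_ball_le e) as [d Hd].
apply (filter_imp (ball (lim (F : (Y -> Prop) -> Prop)) d)).
- intros y. apply Hd.
- apply (@complete_cauchy Y); [exact HF|]. intros e'.
  destruct (renorm_ball_ge e') as [d' Hd']. destruct (HC d') as [x Hx].
  exists x. revert Hx. apply (filter_imp (F := F)). intros y. apply Hd'.
Qed.

Lemma renorm_close_lim (F1 F2 : (renorm_NormedModule -> Prop) -> Prop) :
  filter_le F1 F2 -> filter_le F2 F1 ->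
  close (lim (F1 : (Y -> Prop) -> Prop) : renorm_NormedModule)
    (lim (F2 : (Y -> Prop) -> Prop) : renorm_NormedModule).
Proof.
intros H1 H2 e. destruct (renorm_ball_le e) as [d Hd].
apply Hd. apply (@close_lim Y F1 F2 H1 H2).
Qed.

(* The Banach space [Y] with [N] in place of its norm. *)
Definition renorm : CompleteNormedModule (scalars k) :=
  CompleteNormedModule.Pack (scalars k) Y
    (CompleteNormedModule.Class (scalars k) Y
      (NormedModule.class (scalars k) renorm_NormedModule)
      (CompleteSpace.Mixin renorm_NormedModule lim
        renorm_complete renorm_close_lim))
    Y.

End Renorm.

(* Main.v *)
Require Import Defs.
From Stdlib Require Import Reals Lra Lia List.
From Stdlib Require Import Classical FunctionalExtensionality IndefiniteDescription.
From Coquelicot Require Import Coquelicot.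
From mathcomp Require boolp classical_sets.

Set Implicit Arguments.
Unset Strict Implicit.

(** The inclusion [closed convex hull of W(T)] in [V(T)] becomes strict when
    the norm of [J + T] is approached on the sphere of [X] by vectors [x] and
    functionals [g] with [g x] close to 1, while no pair with [g x] equal to 1
    is of the same kind. The smallest example has rank one. Let [e] be a vector
    outside [X] and [f] a functional of norm 1 on [X] which does not attain its
    norm, and suppose that

      [norm (x + s e) = max (norm x, |f x| + |s|)]  for [x] in [X].

    If [norm x = 1] then [|f x| < 1], so that adding a small multiple of [e]
    does not change the norm of [x]; hence every functional of norm 1 with
    value 1 at [x] kills [e], and [T x = f(x) e] has [W(T)] contained in [{0}].
    On the other hand [norm (J + T) = 2] while [J] and [T] have norm at most 1,
    so a norming functional of [J + T] takes the value 1 at both, and 1 lies in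
    [V(T)]. This is [FR_obstruction].

    It remains to produce such a norm on a non-reflexive space [Y]. Let [F] in
    the bidual be at positive distance from [Y]. Helly's theorem, applied
    alternately in the dual of [Y] (to [F] and finitely many points) and in [Y]
    (to finitely many functionals), yields bounded sequences with [f_i x_n = 1]
    for [i <= n] and [f_n x_j = 0] for [j < n]: this is [triangular_system],
    which also provides [e] and [h] with [h e = 1], [f_n e = 0] and
    [h x_n = 0]. Put [w y = sup_n |f_0 y - f_n y| / (n + 1)], and take

      [N y = max (|f_0 y| + max (w y, |h y|), norm (y - h(y) e) / C)],

    [X = {y : h y = 0 and f_n y -> 0}] and [f = f_0]. Equality [|f_0 y| = N y]
    forces [w y = 0], that is [f_n y = f_0 y] for all [n], whence [f_0 y = 0] on
    [X]: the norm of [f_0] is not attained on [X]. It is however approached,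
    because [f_0 x_n = 1] and [N x_n <= 1 + 1/n].

    Both the norming functionals and Helly's theorem come from one form of the
    Hahn-Banach theorem, [hahn_banach], stated for an arbitrary seminorm. *)

(** * Scalars and infima *)

Definition real_part {k : real_or_complex} : scalars k -> R :=
  match k return scalars k -> R with
  | RealField => fun t => t
  | ComplexField => fun z : C => fst z
  end.

Section Scalars.

Context {k : real_or_complex}.

Lemma abs_mult_eq (a b : scalars k) : abs (mult a b) = abs a * abs b.
Proof.
destruct k; [exact (Rabs_mult a b) | exact (Cmod_mult a b)].
Qed.

Lemma abs_real (t : R) : abs (of_real k t) = Rabs t.
Proof. destruct k; [reflexivity | exact (Cmod_R t)]. Qed.

Lemma abs_scalars_0 : abs (zero : scalars k) = 0.
Proof. exact abs_zero. Qed.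

Lemma abs_scalars_1 : abs (one : scalars k) = 1.
Proof. exact abs_one. Qed.

Lemma of_real_1 : of_real k 1 = one.
Proof. destruct k; reflexivity. Qed.

Lemma of_real_0 : of_real k 0 = zero.
Proof. destruct k; reflexivity. Qed.

Lemma of_real_plus (s t : R) : of_real k (s + t) = plus (of_real k s) (of_real k t).
Proof. destruct k; [reflexivity | exact (RtoC_plus s t)]. Qed.

Lemma of_real_mult (s t : R) : of_real k (s * t) = mult (of_real k s) (of_real k t).
Proof. destruct k; [reflexivity | exact (RtoC_mult s t)]. Qed.

Lemma real_part_of_real (t : R) : real_part (of_real k t) = t.
Proof. destruct k; reflexivity. Qed.

Lemma real_part_plus (a b : scalars k) : real_part (plus a b) = real_part a + real_part b.
Proof. destruct k; reflexivity. Qed.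

Lemma real_part_le_abs (a : scalars k) : real_part a <= abs a.
Proof.
destruct k.
- exact (Rle_abs a).
- exact (Rle_trans _ _ _ (Rle_abs _) (re_le_Cmod a)).
Qed.

Lemma real_part_ge_abs (a : scalars k) (r : R) :
  r <= real_part a -> abs a <= r -> a = of_real k r.
Proof.
destruct k; simpl; intros H1 H2.
- change (Rabs a <= r) in H2. generalize (Rle_abs a). simpl in *. lra.
- change (Cmod a <= r) in H2. destruct a as [a b]; simpl in *.
  assert (Ha : a = r).
  { generalize (re_le_Cmod (a, b)) (Rle_abs a); simpl; lra. }
  subst a. unfold RtoC. f_equal.
  assert (Hr : 0 <= r) by (generalize (Cmod_ge_0 (r, b)); lra).
  apply (Rmult_le_compat _ _ _ _ (Cmod_ge_0 _) (Cmod_ge_0 _) H2) in H2.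
  unfold Cmod in H2. rewrite sqrt_sqrt in H2 by (simpl; nra). simpl in H2. nra.
Qed.

(** The unimodular factor through which a bound on real parts becomes a bound on
    absolute values. *)
Lemma phase (a : scalars k) :
  exists w, abs w = 1 /\ mult w a = of_real k (abs a).
Proof.
destruct (classic (a = zero)) as [->|Ha].
- exists one. split; [exact abs_one|]. rewrite mult_one_l, abs_zero, of_real_0. reflexivity.
- destruct (@scalars_inv k a Ha) as [b [Hb1 Hb2]].
  exists (mult (of_real k (abs a)) b). split.
  + rewrite abs_mult_eq, abs_real, Rabs_pos_eq by apply abs_ge_0. lra.
  + rewrite <- mult_assoc, Hb1, mult_one_r. reflexivity.
Qed.

End Scalars.

Definition inf (A : R -> Prop) : R := real (Glb_Rbar A).

Lemma inf_lb (A : R -> Prop) (m r : R) :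
  (forall s, A s -> m <= s) -> A r -> inf A <= r.
Proof.
intros Hm Hr. unfold inf.
destruct (Glb_Rbar_correct A) as [H1 H2].
specialize (H1 r Hr). specialize (H2 (Finite m) Hm).
destruct (Glb_Rbar A); simpl in *; tauto.
Qed.

Lemma inf_glb (A : R -> Prop) (m : R) :
  (exists r, A r) -> (forall s, A s -> m <= s) -> m <= inf A.
Proof.
intros [r Hr] Hm. unfold inf.
destruct (Glb_Rbar_correct A) as [H1 H2].
specialize (H1 r Hr). specialize (H2 (Finite m) Hm).
destruct (Glb_Rbar A); simpl in *; tauto.
Qed.

Lemma inf_plus_glb (A B : R -> Prop) (m : R) :
  (exists r, A r) -> (exists r, B r) ->
  (forall r s, A r -> B s -> m <= r + s) -> m <= inf A + inf B.
Proof.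
intros HA HB Hm. assert (H : m - inf B <= inf A); [|lra].
apply inf_glb; [exact HA|]. intros r Hr. assert (H : m - r <= inf B); [|lra].
apply inf_glb; [exact HB|]. intros s Hs. specialize (Hm r s Hr Hs). lra.
Qed.

Lemma inf_mult_glb (A : R -> Prop) (t m : R) :
  (exists r, A r) -> 0 <= t -> (forall r, A r -> m <= t * r) -> m <= t * inf A.
Proof.
intros HA [Ht|<-] Hm.
- assert (H : m / t <= inf A).
  { apply inf_glb; [exact HA|]. intros r Hr. apply Rmult_le_reg_l with t; [exact Ht|].
    replace (t * (m / t)) with m by (field; lra). apply Hm, Hr. }
  apply Rmult_le_compat_l with (r := t) in H; [|lra].
  replace (t * (m / t)) with m in H by (field; lra). exact H.
- destruct HA as [r Hr]. specialize (Hm r Hr). lra.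
Qed.

Lemma inf_approx (A : R -> Prop) (m c : R) :
  (exists r, A r) -> (forall s, A s -> m <= s) -> inf A < c ->
  exists s, A s /\ s < c.
Proof.
intros HA Hm Hc. apply NNPP. intros HN.
assert (H : c <= inf A); [|lra].
apply inf_glb; [exact HA|]. intros s Hs. apply Rnot_lt_le. intros Hsc.
apply HN. exists s. auto.
Qed.

(** * The Hahn-Banach theorem *)

Section HahnBanach.

Context {k : real_or_complex} {E : ModuleSpace (scalars k)}.

(** The vector space laws at the structures of [E]; their general forms mention
    other projections of the hierarchy, which rewriting does not identify with
    these. *)
Lemma vplusC (x y : E) : plus x y = plus y x.
Proof. exact (plus_comm x y). Qed.
Lemma vplusA (x y z : E) : plus x (plus y z) = plus (plus x y) z.
Proof. exact (plus_assoc x y z). Qed.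
Lemma vplus0 (x : E) : plus x zero = x.
Proof. exact (plus_zero_r x). Qed.
Lemma vplusN (x : E) : plus x (opp x) = zero.
Proof. exact (plus_opp_r x). Qed.
Lemma voppD (x y : E) : opp (plus x y) = plus (opp x) (opp y).
Proof. exact (opp_plus x y). Qed.
Lemma vscalA (a b : scalars k) (x : E) : scal a (scal b x) = scal (mult a b) x.
Proof. exact (scal_assoc a b x). Qed.
Lemma vscalDr (a : scalars k) (x y : E) : scal a (plus x y) = plus (scal a x) (scal a y).
Proof. exact (scal_distr_l a x y). Qed.
Lemma vscalDl (a b : scalars k) (x : E) : scal (plus a b) x = plus (scal a x) (scal b x).
Proof. exact (scal_distr_r a b x). Qed.
Lemma vplusACA (x y z w : E) :
  plus (plus x y) (plus z w) = plus (plus x z) (plus y w).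
Proof. rewrite <- !vplusA. f_equal. rewrite !vplusA. f_equal. apply vplusC. Qed.

Definition rscal (t : R) (x : E) : E := scal (of_real k t) x.

Lemma rscal_plus_l s t x : rscal (s + t) x = plus (rscal s x) (rscal t x).
Proof. unfold rscal. rewrite of_real_plus. exact (scal_distr_r (of_real k s) (of_real k t) x). Qed.
Lemma rscal_plus_r t x y : rscal t (plus x y) = plus (rscal t x) (rscal t y).
Proof. exact (scal_distr_l _ x y). Qed.
Lemma rscal_rscal s t x : rscal s (rscal t x) = rscal (s * t) x.
Proof. unfold rscal. rewrite of_real_mult. exact (scal_assoc (of_real k s) (of_real k t) x). Qed.
Lemma rscal_0 x : rscal 0 x = zero.
Proof. unfold rscal. rewrite of_real_0. exact (scal_zero_l x). Qed.
Lemma rscal_1 x : rscal 1 x = x.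
Proof. unfold rscal. rewrite of_real_1. exact (scal_one x). Qed.
Lemma rscal_opp t x : rscal t (opp x) = opp (rscal t x).
Proof. exact (scal_opp_r _ x). Qed.

(** The inequality in [sublinear_rscal] forces equality, by applying it to
    [/ t] as well; for an infimum this inequality is the natural one to check. *)
Record sublinear (q : E -> R) : Prop := {
  sublinear_plus : forall x y, q (plus x y) <= q x + q y;
  sublinear_rscal : forall t x, 0 <= t -> q (rscal t x) <= t * q x
}.

Lemma sublinear_zero q : sublinear q -> q zero = 0.
Proof.
intros [H1 H2]. generalize (H1 zero zero) (H2 0 zero (Rle_refl 0)).
rewrite rscal_0, vplus0. lra.
Qed.

Lemma sublinear_opp q x : sublinear q -> - q (opp x) <= q x.
Proof.
intros Hq. generalize (sublinear_plus Hq x (opp x)).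
rewrite vplusN, (sublinear_zero Hq). lra.
Qed.

(** The common bound [p] keeps the members of the chain above [- p (opp x)] at
    each [x], so that their pointwise infimum is finite. *)
Lemma sublinear_chain_inf (p : E -> R) (A : (E -> R) -> Prop) :
  (exists q, A q) ->
  (forall q, A q -> sublinear q /\ forall x, q x <= p x) ->
  (forall q r, A q -> A r -> (forall x, q x <= r x) \/ (forall x, r x <= q x)) ->
  exists u, sublinear u /\ forall q x, A q -> u x <= q x.
Proof.
intros [q0 Hq0] HA Hchain.
set (V := fun x r => exists q, A q /\ r = q x).
assert (HV : forall x r, V x r -> - p (opp x) <= r).
{ intros x r [q [Hq ->]]. destruct (HA q Hq) as [Hs Hp].
  generalize (sublinear_opp x Hs) (Hp (opp x)). lra. }
assert (Hle : forall q x, A q -> inf (V x) <= q x).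
{ intros q x Hq. apply (inf_lb (HV x)). exists q. auto. }
assert (Hne : forall x, exists r, V x r).
{ intros x. exists (q0 x), q0. auto. }
exists (fun x => inf (V x)). split; [split|exact Hle].
- intros x y. apply inf_plus_glb; auto.
  intros r s [q [Hq ->]] [q' [Hq' ->]].
  (* The larger of the two members of the chain may be replaced by the smaller. *)
  assert (H : exists v, A v /\ v x <= q x /\ v y <= q' y).
  { destruct (Hchain q q' Hq Hq') as [H|H].
    - exists q. split; [exact Hq|]. split; [lra|apply H].
    - exists q'. split; [exact Hq'|]. split; [apply H|lra]. }
  destruct H as [v [Hv [H1 H2]]].
  generalize (Hle v (plus x y) Hv) (sublinear_plus (proj1 (HA v Hv)) x y). lra.
- intros t x Ht. apply inf_mult_glb; auto. intros r [q [Hq ->]].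
  exact (Rle_trans _ _ _ (Hle q _ Hq) (sublinear_rscal (proj1 (HA q Hq)) x Ht)).
Qed.

Lemma minimal_sublinear (p : E -> R) :
  sublinear p ->
  exists q, sublinear q /\ (forall x, q x <= p x) /\
    forall r, sublinear r -> (forall x, r x <= q x) -> forall x, q x <= r x.
Proof.
intros Hp.
set (P := fun q : E -> R => sublinear q /\ forall x, q x <= p x).
destruct (@classical_sets.Zorn (sig P)
  (fun q r => boolp.asbool (forall x, proj1_sig r x <= proj1_sig q x)))
  as [[q [Hq Hqp]] Hmin].
- intros q. apply boolp.asboolT. intros x. apply Rle_refl.
- intros q r s H1 H2. apply boolp.asboolT. intros x.
  exact (Rle_trans _ _ _ (boolp.asboolW H2 x) (boolp.asboolW H1 x)).
- intros q r H1 H2. apply sig_eq, functional_extensionality. intros x.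
  exact (Rle_antisym _ _ (boolp.asboolW H2 x) (boolp.asboolW H1 x)).
- intros A HA. destruct (classic (exists q, A q)) as [Hne|Hne].
  + destruct (@sublinear_chain_inf p (fun q => exists Hq : P q, A (exist P q Hq)))
      as [u [Hu Hle]].
    * destruct Hne as [[q Hq] HAq]. exists q, Hq. exact HAq.
    * intros q [Hq _]. exact Hq.
    * intros q r [Hq HAq] [Hr HAr].
      destruct (HA _ _ HAq HAr) as [H|H]; [right|left]; exact (boolp.asboolW H).
    * assert (HPu : P u).
      { split; [exact Hu|]. intros x. destruct Hne as [[q Hq] HAq].
        apply Rle_trans with (q x); [|apply Hq]. apply Hle. exists Hq. exact HAq. }
      exists (exist P u HPu). intros [q Hq] HAq. apply boolp.asboolT. intros x. simpl.
      apply Hle. exists Hq. exact HAq.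
  + assert (HPp : P p) by (split; [exact Hp | intros x; apply Rle_refl]).
    exists (exist P p HPp). intros q Hq. destruct Hne. exists q. exact Hq.
- exists q. split; [exact Hq|]. split; [exact Hqp|]. intros r Hr Hle x.
  assert (HPr : P r).
  { split; [exact Hr|]. intros y. exact (Rle_trans _ _ _ (Hle y) (Hqp y)). }
  specialize (Hmin (exist P r HPr) (boolp.asboolT Hle)).
  injection Hmin as ->. apply Rle_refl.
Qed.

(** The functional is [x |-> inf_(t >= 0) (q (x + t z) - t q z)]; the choice
    [t = 1] gives the value at [opp z]. If [q] is minimal, it shows that
    [q (opp z) = - q z]. *)
Lemma sublinear_directional (q : E -> R) (z : E) :
  sublinear q ->
  exists r, sublinear r /\ (forall x, r x <= q x) /\ r (opp z) <= - q z.
Proof.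
intros Hq.
set (V := fun x v => exists t, 0 <= t /\ v = q (plus x (rscal t z)) - t * q z).
assert (HV : forall x v, V x v -> - q (opp x) <= v).
{ intros x v [t [Ht ->]].
  generalize (sublinear_plus Hq (plus x (rscal t z)) (opp x)).
  rewrite (vplusC x), <- vplusA, vplusN, vplus0.
  destruct (Req_dec t 0) as [->|Ht0].
  - rewrite rscal_0, (sublinear_zero Hq). lra.
  - assert (Hi : 0 <= / t) by (left; apply Rinv_0_lt_compat; lra).
    generalize (sublinear_rscal Hq (rscal t z) Hi).
    rewrite rscal_rscal, Rinv_l, rscal_1 by exact Ht0. intros H1 H2.
    apply Rmult_le_compat_l with (r := t) in H1; [|exact Ht].
    rewrite <- Rmult_assoc, Rinv_r, Rmult_1_l in H1 by exact Ht0. lra. }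
assert (Hle : forall x t, 0 <= t -> inf (V x) <= q (plus x (rscal t z)) - t * q z).
{ intros x t Ht. apply (inf_lb (HV x)). exists t. auto. }
assert (Hne : forall x, exists v, V x v).
{ intros x. eexists. exists 0. split; [apply Rle_refl | reflexivity]. }
exists (fun x => inf (V x)). split; [split|split].
- intros x y. apply inf_plus_glb; auto. intros r' r'' [s [Hs ->]] [t [Ht ->]].
  generalize (Hle (plus x y) (s + t) ltac:(lra)).
  generalize (sublinear_plus Hq (plus x (rscal s z)) (plus y (rscal t z))).
  rewrite vplusACA, rscal_plus_l. lra.
- intros t x Ht. apply inf_mult_glb; auto. intros r [s [Hs ->]].
  eapply Rle_trans; [apply (Hle _ (t * s)); nra|].
  rewrite <- rscal_rscal, <- rscal_plus_r.
  generalize (sublinear_rscal Hq (plus x (rscal s z)) Ht). lra.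
- intros x. generalize (Hle x 0 (Rle_refl 0)). rewrite rscal_0, vplus0. lra.
- generalize (Hle (opp z) 1 Rle_0_1).
  rewrite rscal_1, vplusC, vplusN, (sublinear_zero Hq). lra.
Qed.

(** A minimal sublinear functional is odd by [sublinear_directional], and an odd
    sublinear functional is linear. Minimizing below the directional functional
    of [p] at [z], rather than below [p], fixes the value at [z]; no extension
    from a subspace occurs. *)
Lemma real_hahn_banach (p : E -> R) (z : E) :
  sublinear p ->
  exists l : E -> R,
    (forall x y, l (plus x y) = l x + l y) /\
    (forall t x, l (rscal t x) = t * l x) /\
    (forall x, l x <= p x) /\ l z = p z.
Proof.
intros Hp.
destruct (sublinear_directional z Hp) as [p' [Hp' [Hp'p Hz]]].
destruct (minimal_sublinear Hp') as [l [Hl [Hlp' Hmin]]].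
assert (Hopp : forall x, l (opp x) = - l x).
{ intros x. destruct (sublinear_directional x Hl) as [r [Hr [Hrl Hrx]]].
  generalize (Hmin r Hr Hrl (opp x)) (sublinear_opp x Hl). lra. }
assert (Hplus : forall x y, l (plus x y) = l x + l y).
{ intros x y. apply Rle_antisym; [apply (sublinear_plus Hl)|].
  generalize (sublinear_plus Hl (opp x) (opp y)).
  rewrite <- voppD, !Hopp. lra. }
assert (Hpos : forall t x, 0 <= t -> l (rscal t x) = t * l x).
{ intros t x Ht. apply Rle_antisym; [apply (sublinear_rscal Hl), Ht|].
  generalize (sublinear_rscal Hl (opp x) Ht). rewrite rscal_opp, !Hopp. lra. }
exists l. split; [exact Hplus|]. split; [|split].
- intros t x. destruct (Rle_dec 0 t) as [Ht|Ht]; [apply Hpos, Ht|].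
  generalize (Hpos (- t) x ltac:(lra)) (Hplus (rscal t x) (rscal (- t) x)).
  rewrite <- rscal_plus_l, Rplus_opp_r, rscal_0, (sublinear_zero Hl). lra.
- intros x. exact (Rle_trans _ _ _ (Hlp' x) (Hp'p x)).
- apply Rle_antisym; [exact (Rle_trans _ _ _ (Hlp' z) (Hp'p z))|].
  generalize (Hlp' (opp z)). rewrite Hopp. lra.
Qed.

End HahnBanach.

(** Over the complex numbers [g x = l x - i l (i x)]. *)
Lemma complexify (k : real_or_complex) (E : ModuleSpace (scalars k)) (l : E -> R) :
  (forall x y, l (plus x y) = l x + l y) ->
  (forall t x, l (rscal t x) = t * l x) ->
  exists g : E -> scalars k,
    (forall x y, g (plus x y) = plus (g x) (g y)) /\
    (forall a x, g (scal a x) = mult a (g x)) /\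
    (forall x, real_part (g x) = l x).
Proof.
destruct k; intros Hplus Hscal.
- exists l. split; [exact Hplus|]. split; [exact Hscal | reflexivity].
- exists (fun x => (l x, - l (scal (Ci : scalars ComplexField) x)) : scalars ComplexField).
  split; [|split].
  + intros x y. rewrite vscalDr, !Hplus, Ropp_plus_distr. reflexivity.
  + intros [a b] x.
    assert (Hab : forall y : E, scal ((a, b) : scalars ComplexField) y =
      plus (rscal a y) (rscal b (scal (Ci : scalars ComplexField) y))).
    { intros y. unfold rscal. rewrite vscalA, <- vscalDl. f_equal.
      change ((a, b) = Cplus (RtoC a) (Cmult (RtoC b) Ci)).
      unfold Cplus, Cmult, RtoC, Ci; simpl. f_equal; ring. }
    assert (Hii : scal (Ci : scalars ComplexField) (scal (Ci : scalars ComplexField) x)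
       = rscal (-1) x).
    { unfold rscal. rewrite vscalA. f_equal.
      change (Cmult Ci Ci = RtoC (-1)).
      unfold Cmult, RtoC, Ci; simpl. f_equal; ring. }
    rewrite vscalA, scalars_mult_comm, <- vscalA, !Hab, !Hplus, !Hscal, Hii, Hscal.
    change ((a * l x + b * l (scal (Ci : scalars ComplexField) x),
      - (a * l (scal (Ci : scalars ComplexField) x) + b * (-1 * l x)))
      = Cmult (a, b) (l x, - l (scal (Ci : scalars ComplexField) x))).
    unfold Cmult; simpl. f_equal; ring.
  + reflexivity.
Qed.

Theorem hahn_banach (k : real_or_complex) (E : ModuleSpace (scalars k))
    (q : E -> R) (z : E) :
  (forall x y, q (plus x y) <= q x + q y) ->
  (forall a x, q (scal a x) <= abs a * q x) ->
  exists g : E -> scalars k,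
    (forall x y, g (plus x y) = plus (g x) (g y)) /\
    (forall a x, g (scal a x) = mult a (g x)) /\
    (forall x, abs (g x) <= q x) /\ g z = of_real k (q z).
Proof.
intros Hplus Hscal.
assert (Hq : sublinear q).
{ split; [exact Hplus|]. intros t x Ht. eapply Rle_trans; [apply Hscal|].
  rewrite abs_real, Rabs_pos_eq by exact Ht. apply Rle_refl. }
destruct (real_hahn_banach z Hq) as [l [Hl1 [Hl2 [Hl3 Hl4]]]].
destruct (complexify Hl1 Hl2) as [g [Hg1 [Hg2 Hg3]]].
assert (Hg : forall x, abs (g x) <= q x).
{ intros x. destruct (phase (g x)) as [w [Hw Hwx]].
  rewrite <- (real_part_of_real (k := k) (abs (g x))), <- Hwx, <- Hg2, Hg3.
  eapply Rle_trans; [apply Hl3|]. generalize (Hscal w x). rewrite Hw. lra. }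
exists g. split; [exact Hg1|]. split; [exact Hg2|]. split; [exact Hg|].
apply real_part_ge_abs; [rewrite Hg3; lra | apply Hg].
Qed.

(** * Solving finitely many linear equations with control of the norm *)

Section Functionals.

Context {k : real_or_complex}.

(** Ring operations on [scalars k] typed uniformly, for the [ring] tactic: the
    operations met in goals are the same up to conversion, but are reached
    through different levels of the algebraic hierarchy. *)
Let sadd (a b : scalars k) : scalars k := plus a b.
Let smul (a b : scalars k) : scalars k := mult a b.
Let sopp (a : scalars k) : scalars k := opp a.
Let szero : scalars k := zero.
Let sone : scalars k := one.

Lemma scalars_ring :
  ring_theory szero sone sadd smul (fun a b => sadd a (sopp b)) sopp eq.
Proof.
split; intros.
- exact (plus_zero_l x).
- exact (plus_comm x y).
- exact (plus_assoc x y z).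
- exact (mult_one_l x).
- apply scalars_mult_comm.
- exact (mult_assoc x y z).
- exact (mult_distr_r x y z).
- reflexivity.
- exact (plus_opp_r x).
Qed.

Add Ring scalars_ring_tac : scalars_ring.

Ltac sring :=
  repeat match goal with
  | |- context [@plus ?G ?a ?b] => change (@plus G a b) with (sadd a b)
  | |- context [@mult ?G ?a ?b] => change (@mult G a b) with (smul a b)
  | |- context [@opp ?G ?a] => change (@opp G a) with (sopp a)
  | |- context [@zero ?G] => change (@zero G) with szero
  | |- context [@one ?G] => change (@one G) with sone
  end;
  match goal with |- @eq _ ?a ?b => change (@eq (AbsRing.sort (scalars k)) a b) end;
  ring.

Section Dual.

Context {Z : NormedModule (scalars k)}.

Lemma dual_app_zero (f : dual Z) : dual_app f zero = zero.
Proof. exact (linear_zero _ (proj2_sig f)). Qed.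

Lemma dual_app_plus (f : dual Z) (x y : Z) :
  dual_app f (plus x y) = plus (dual_app f x) (dual_app f y).
Proof. exact (linear_plus _ (proj2_sig f) x y). Qed.

Lemma dual_app_scal (f : dual Z) (a : scalars k) (x : Z) :
  dual_app f (scal a x) = mult a (dual_app f x).
Proof. exact (linear_scal _ (proj2_sig f) a x). Qed.

Lemma dual_plus_app (f g : dual Z) (x : Z) :
  dual_app (plus f g) x = plus (dual_app f x) (dual_app g x).
Proof. reflexivity. Qed.

Lemma dual_scal_app (a : scalars k) (f : dual Z) (x : Z) :
  dual_app (scal a f) x = mult a (dual_app f x).
Proof. reflexivity. Qed.

Lemma dual_app_bound (f : dual Z) (x : Z) :
  abs (dual_app f x) <= norm f * norm x.
Proof. exact (dual_norm_ub f x). Qed.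

Lemma dual_ext (f g : dual Z) :
  (forall x, dual_app f x = dual_app g x) -> f = g.
Proof. intros H. apply sig_eq, functional_extensionality, H. Qed.

Lemma dual_make (g : Z -> scalars k) (M : R) :
  0 <= M ->
  (forall x y, g (plus x y) = plus (g x) (g y)) ->
  (forall a x, g (scal a x) = mult a (g x)) ->
  (forall x, abs (g x) <= M * norm x) ->
  exists f : dual Z, norm f <= M /\ forall x, dual_app f x = g x.
Proof.
intros HM H1 H2 H3.
assert (Hg : is_functional (g : Z -> AbsRing_NormedModule (scalars k))).
{ split; [exact H1 | exact H2 |]. exists (M + 1). split; [lra|]. intros x.
  eapply Rle_trans; [exact (H3 x)|]. generalize (norm_ge_0 x). nra. }
exists (exist _ g Hg). split; [|reflexivity].
apply dual_norm_le; [exact HM|]. intros y Hy. simpl.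
eapply Rle_trans; [exact (H3 y)|]. generalize (norm_ge_0 y). nra.
Qed.

Lemma norm_scal_eq (a : scalars k) (x : Z) : norm (scal a x) = abs a * norm x.
Proof. exact (is_norm_scal (is_norm_norm Z) a x). Qed.

Theorem norming_functional (z : Z) :
  exists f : dual Z, norm f <= 1 /\ dual_app f z = of_real k (norm z).
Proof.
destruct (@hahn_banach k Z norm z) as [g [H1 [H2 [H3 H4]]]].
- intros x y. exact (norm_triangle x y).
- intros a x. exact (norm_scal a x).
- destruct (@dual_make g 1) as [f [Hf Hfg]]; auto using Rle_0_1.
  + intros x. rewrite Rmult_1_l. apply H3.
  + exists f. split; [exact Hf|]. rewrite Hfg. exact H4.
Qed.

(** A functional vanishing on the common kernel of finitely many others is a
    linear combination of them. Linear combinations are encoded as membership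
    in every submodule [P] that contains the list, which makes coefficients
    unnecessary. In the induction step, either [f] vanishes on the common kernel
    of [l] and can be dropped, or a multiple of [f] corrects [g] so that it
    vanishes there. *)
Lemma common_kernel (P : dual Z -> Prop) (l : list (dual Z)) :
  is_submodule P -> (forall f, In f l -> P f) ->
  forall g : dual Z,
    (forall z, (forall f, In f l -> dual_app f z = zero) -> dual_app g z = zero) ->
    P g.
Proof.
intros HP. induction l as [|f l IH]; intros Hl g Hg.
- replace g with (zero : dual Z); [exact (submodule_zero HP)|].
  apply dual_ext. intros z. symmetry. apply Hg. intros f [].
- assert (Hl' : forall f', In f' l -> P f') by (intros; apply Hl; right; assumption).
  destruct (classic (exists z0,
    (forall f', In f' l -> dual_app f' z0 = zero) /\ dual_app f z0 <> zero))
    as [[z0 [Hz0 Hfz0]]|Hno].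
  + destruct (scalars_inv Hfz0) as [b [Hb _]].
    set (c := mult b (dual_app g z0)).
    replace g with (plus (plus g (scal (opp c) f)) (scal c f)).
    * apply (submodule_plus HP); [|exact (submodule_scal HP c (Hl f (or_introl eq_refl)))].
      apply (IH Hl'). intros z Hz.
      rewrite dual_plus_app, dual_scal_app.
      assert (H : dual_app g (plus z (scal (opp (mult b (dual_app f z))) z0)) = zero).
      { apply Hg. intros f' [<-|Hf'].
        - rewrite dual_app_plus, dual_app_scal.
          replace (mult (opp (mult b (dual_app f z))) (dual_app f z0))
            with (opp (mult (mult b (dual_app f z0)) (dual_app f z))) by sring.
          rewrite Hb. sring.
        - rewrite dual_app_plus, dual_app_scal, (Hz f' Hf'), (Hz0 f' Hf'). sring. }
      rewrite dual_app_plus, dual_app_scal in H. rewrite <- H. unfold c. sring.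
    * apply dual_ext. intros z. rewrite !dual_plus_app, !dual_scal_app. sring.
  + apply (IH Hl'). intros z Hz. apply Hg. intros f' [<-|Hf']; [|auto].
    apply NNPP. intros Hne. apply Hno. exists z. auto.
Qed.

(** Helly's theorem: the distance from [z0] to the common kernel of [l] equals
    the value at [z0] of a functional of norm at most 1 that vanishes on this
    kernel, hence lies in the span of [l], where the hypothesis bounds it. *)
Lemma helly (P : dual Z -> Prop) (l : list (dual Z)) (z0 : Z) (M : R) :
  is_submodule P -> (forall f, In f l -> P f) ->
  (forall f, P f -> norm f <= 1 -> abs (dual_app f z0) <= M) ->
  forall e, 0 < e -> exists z, norm z <= M + e /\
    forall f, In f l -> dual_app f z = dual_app f z0.
Proof.
intros HP Hl HM e He.
set (N := fun n : Z => forall f, In f l -> dual_app f n = zero).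
set (V := fun z r => exists n : Z, N n /\ r = norm (plus z n)).
assert (HV : forall z r, V z r -> 0 <= r).
{ intros z r [n [_ ->]]. apply norm_ge_0. }
assert (HN0 : N zero).
{ intros f _. apply dual_app_zero. }
assert (HNplus : forall n m, N n -> N m -> N (plus n m)).
{ intros n m Hn Hm f Hf. rewrite dual_app_plus, (Hn f Hf), (Hm f Hf). sring. }
assert (HNscal : forall a n, N n -> N (scal a n)).
{ intros a n Hn f Hf. rewrite dual_app_scal, (Hn f Hf). sring. }
assert (Hne : forall z, exists r, V z r).
{ intros z. exists (norm (plus z zero)), zero. auto. }
assert (Hle : forall z n, N n -> inf (V z) <= norm (plus z n)).
{ intros z n Hn. apply (inf_lb (HV z)). exists n. auto. }
destruct (@hahn_banach k Z (fun z => inf (V z)) z0) as [g [H1 [H2 [H3 H4]]]].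
- change (forall x y : Z, inf (V (plus x y)) <= inf (V x) + inf (V y)).
  intros x y. apply inf_plus_glb; auto. intros r s [n [Hn ->]] [m [Hm ->]].
  eapply Rle_trans; [exact (Hle (plus x y) (plus n m) (HNplus n m Hn Hm))|].
  eapply Rle_trans; [|exact (norm_triangle (plus x n) (plus y m))].
  right. apply (f_equal norm). exact (vplusACA x y n m).
- change (forall (a : scalars k) (x : Z), inf (V (scal a x)) <= abs a * inf (V x)).
  intros a x. apply inf_mult_glb; auto using abs_ge_0. intros r [n [Hn ->]].
  eapply Rle_trans; [exact (Hle _ _ (HNscal a n Hn))|].
  eapply Rle_trans; [|exact (norm_scal a (plus x n))].
  right. apply (f_equal norm). symmetry. exact (scal_distr_l a x n).
- assert (Hg1 : forall z, abs (g z) <= 1 * norm z).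
  { intros z. rewrite Rmult_1_l. eapply Rle_trans; [apply H3|].
    eapply Rle_trans; [exact (Hle z zero HN0)|].
    right. apply (f_equal norm). exact (plus_zero_r z). }
  destruct (dual_make Rle_0_1 H1 H2 Hg1) as [f [Hf Hfg]].
  assert (Hz0 : inf (V z0) <= M).
  { assert (H0 : 0 <= inf (V z0)).
    { apply inf_glb; [apply Hne | apply HV]. }
    rewrite <- (Rabs_pos_eq (inf (V z0)) H0), <- (abs_real (k := k)).
    rewrite <- H4, <- Hfg. apply HM; [|exact Hf].
    apply (common_kernel HP Hl). intros n Hn. rewrite Hfg. apply abs_eq_zero.
    apply Rle_antisym; [|apply abs_ge_0]. eapply Rle_trans; [apply H3|].
    eapply Rle_trans; [exact (Hle n (scal (opp one) n) (HNscal _ n Hn))|].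
    right. rewrite <- (norm_zero (V := Z)). apply (f_equal norm).
    rewrite (scal_opp_one n : scal (opp one) n = opp n). exact (plus_opp_r n). }
  destruct (inf_approx (Hne z0) (HV z0) (c := M + e)) as [r [[n [Hn ->]] Hr]]; [lra|].
  exists (plus z0 n). split; [lra|]. intros f' Hf'.
  rewrite dual_app_plus, (Hn f' Hf'). sring.
Qed.

End Dual.

(** An exact solution [z0] of the finitely many equations exists by linear
    algebra; on the span of [l] evaluation at [z0] agrees with [F], which bounds
    it by [norm F]. *)
Lemma helly_bidual (Z : NormedModule (scalars k)) (F : dual (dual Z)) (l : list (dual Z)) :
  exists x : Z, norm x <= norm F + 1 /\
    forall f, In f l -> dual_app f x = dual_app F f.
Proof.
assert (HP : forall z, is_submodule (fun f : dual Z => dual_app f z = dual_app F f)).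
{ intros z. split.
  - change (zero = dual_app F (zero : dual Z)). symmetry. apply (dual_app_zero F).
  - intros f g Hf Hg.
    change (plus (dual_app f z) (dual_app g z) = dual_app F (plus f g : dual Z)).
    rewrite Hf, Hg. symmetry. exact (dual_app_plus F f g).
  - intros a f Hf.
    change (mult a (dual_app f z) = dual_app F (scal a f : dual Z)).
    rewrite Hf. symmetry. exact (dual_app_scal F a f). }
assert (Hz : exists z : Z, forall f, In f l -> dual_app f z = dual_app F f).
{ induction l as [|f l [z IH]].
  - exists zero. intros f [].
  - destruct (classic (exists z1,
      (forall f', In f' l -> dual_app f' z1 = zero) /\ dual_app f z1 <> zero))
      as [[z1 [Hz1 Hfz1]]|Hno].
    + destruct (scalars_inv Hfz1) as [b [Hb _]].
      exists (plus z (scal (mult (plus (dual_app F f) (opp (dual_app f z))) b) z1)).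
      intros f' [<-|Hf'].
      * rewrite dual_app_plus, dual_app_scal, <- mult_assoc, Hb. sring.
      * rewrite dual_app_plus, dual_app_scal, (Hz1 f' Hf'), (IH f' Hf'). sring.
    + exists z. intros f' [<-|Hf']; [|auto].
      apply (common_kernel (HP z) IH). intros z1 Hz1.
      apply NNPP. intros Hne. apply Hno. exists z1. auto. }
destruct Hz as [z0 Hz0].
destruct (@helly Z _ l z0 (norm F) (HP z0) Hz0) with (e := 1) as [z [Hz Hzl]].
- intros f Hf Hf1. rewrite Hf. eapply Rle_trans; [apply (dual_app_bound F f)|].
  generalize (norm_ge_0 F). nra.
- lra.
- exists z. split; [exact Hz|]. intros f Hf. rewrite (Hzl f Hf). apply Hz0, Hf.
Qed.

(** * A triangular system in a non-reflexive space *)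

Lemma dual_app_minus (Z : NormedModule (scalars k)) (f : dual Z) (x y : Z) :
  dual_app f (minus x y) = plus (dual_app f x) (opp (dual_app f y)).
Proof.
transitivity (plus (dual_app f x) (dual_app f (scal (opp one) y))).
- replace (minus x y) with (plus x (scal (opp one) y)); [exact (dual_app_plus f x _)|].
  apply (f_equal (plus x)). exact (scal_opp_one y).
- rewrite dual_app_scal. sring.
Qed.

Lemma abs_opp_eq (a : scalars k) : abs (opp a) = abs a.
Proof.
replace (opp a) with (mult (opp one) a) by sring.
rewrite abs_mult_eq, abs_opp_one. ring.
Qed.

(** The image of [Y] in the bidual is closed: if it came arbitrarily close to
    [- F], the points doing so would form a Cauchy filter, the embedding being
    isometric by [norming_functional], and its limit would represent [- F]. *)
Lemma bidual_distance (Y : CompleteNormedModule (scalars k)) (F : dual (dual Y)) :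
  (forall y : Y, canonical_embedding y <> F) ->
  exists d, 0 < d /\ forall y : Y, d <= norm (plus F (canonical_embedding y)).
Proof.
intros HF. apply NNPP. intros Hno.
assert (Hclose : forall d, 0 < d ->
    exists y : Y, norm (plus F (canonical_embedding y)) < d).
{ intros d Hd. apply NNPP. intros Hd'. apply Hno. exists d. split; [exact Hd|].
  intros y. apply Rnot_lt_le. intros Hy. apply Hd'. exists y. exact Hy. }
set (Fi := fun G : Y -> Prop => exists d, 0 < d /\
  forall y, norm (plus F (canonical_embedding y)) < d -> G y).
assert (HFi : ProperFilter Fi).
{ split; [|split].
  - intros G [d [Hd HG]]. destruct (Hclose d Hd) as [y Hy]. exists y. auto.
  - exists 1. split; [lra | auto].
  - intros G H [d [Hd HG]] [d' [Hd' HH]]. exists (Rmin d d').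
    split; [apply Rmin_pos; assumption|]. intros y Hy.
    split; [apply HG | apply HH]; eapply Rlt_le_trans; try exact Hy;
      [apply Rmin_l | apply Rmin_r].
  - intros G H HGH [d [Hd HG]]. exists d. auto. }
assert (Happ : forall (y : Y) (f : dual Y),
  abs (plus (dual_app F f) (dual_app f y)) <=
    norm (plus F (canonical_embedding y)) * norm f).
{ intros y f. exact (dual_app_bound (plus F (canonical_embedding y)) f). }
assert (HC : cauchy Fi).
{ intros eps. assert (He : 0 < eps / 2) by (generalize (cond_pos eps); lra).
  destruct (Hclose _ He) as [y0 Hy0]. exists y0, (eps / 2).
  split; [exact He|]. intros y Hy. apply (norm_compat1 (V := Y)).
  destruct (norming_functional (minus y y0)) as [f [Hf Hfn]].
  rewrite <- (Rabs_pos_eq _ (norm_ge_0 (minus y y0))), <- (abs_real (k := k)), <- Hfn.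
  rewrite dual_app_minus.
  replace (plus (dual_app f y) (opp (dual_app f y0)))
    with (plus (plus (dual_app F f) (dual_app f y))
               (opp (plus (dual_app F f) (dual_app f y0)))) by sring.
  eapply Rle_lt_trans; [apply abs_triangle|]. rewrite abs_opp_eq.
  generalize (Happ y f) (Happ y0 f).
  generalize (norm_ge_0 (plus F (canonical_embedding y)))
    (norm_ge_0 (plus F (canonical_embedding y0))) (norm_ge_0 f). nra. }
set (y := lim Fi : Y). apply (HF (scal (opp one) y)). apply dual_ext. intros f.
transitivity (mult (opp one) (dual_app f y)); [exact (dual_app_scal f (opp one) y)|].
assert (H0 : plus (dual_app F f) (dual_app f y) = zero).
{ apply abs_eq_zero. apply Rle_antisym; [|apply abs_ge_0].
  apply Rnot_lt_le. set (v := abs _). intros Hv.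
  set (c := norm f * (1 + norm_factor (V := Y))).
  assert (Hc : 0 <= c).
  { unfold c. generalize (norm_ge_0 f) (norm_factor_gt_0 (V := Y)). nra. }
  assert (He : 0 < v / (c + 1)) by (apply Rdiv_lt_0_compat; lra).
  destruct (complete_cauchy Fi HFi HC (mkposreal _ He)) as [d [Hd Hball]].
  destruct (Hclose (Rmin d (v / (c + 1)))) as [y' Hy'];
    [apply Rmin_pos; assumption|].
  assert (Hy1 := Rlt_le_trans _ _ _ Hy' (Rmin_l _ _)).
  assert (Hy2 := Rlt_le_trans _ _ _ Hy' (Rmin_r _ _)).
  apply Hball, (norm_compat2 (V := Y)) in Hy1. simpl in Hy1.
  assert (Hv' : v <= c * (v / (c + 1))).
  { unfold v at 1.
    replace (plus (dual_app F f) (dual_app f y))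
      with (plus (plus (dual_app F f) (dual_app f y')) (opp (dual_app f (minus y' y)))).
    - eapply Rle_trans; [apply abs_triangle|]. rewrite abs_opp_eq.
      eapply Rle_trans; [apply Rplus_le_compat; [apply Happ | apply dual_app_bound]|].
      set (w := v / (c + 1)) in *.
      apply Rle_trans with (w * norm f + norm f * (norm_factor (V := Y) * w)).
      + apply Rplus_le_compat; [apply Rmult_le_compat_r | apply Rmult_le_compat_l];
          [apply norm_ge_0 | left; exact Hy2 | apply norm_ge_0 | left; exact Hy1].
      + right. unfold c. ring.
    - rewrite dual_app_minus. sring. }
  replace (c * (v / (c + 1))) with (v - v / (c + 1)) in Hv' by (field; lra). lra. }
replace (dual_app F f) with (plus (plus (dual_app F f) (dual_app f y))
  (mult (opp one) (dual_app f y))) by sring.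
rewrite H0. sring.
Qed.

(** Helly's theorem in the dual of [Y], for [F] and the evaluations at the points
    of [l]. A combination [a F + y] with [y] in the span of [l] has norm at
    least [|a| d], and takes the value [a] at a functional [f0] with
    [F f0 = 1] that vanishes on [l]. *)
Lemma annihilating_functional (Y : NormedModule (scalars k)) (F : dual (dual Y)) (d : R) :
  0 < d -> (forall y : Y, d <= norm (plus F (canonical_embedding y))) ->
  forall l : list Y, exists f : dual Y, norm f <= / d + 1 /\
    dual_app F f = one /\ forall y, In y l -> dual_app f y = zero.
Proof.
intros Hd HF l.
assert (Hcan : forall x y : Y, canonical_embedding (plus x y)
  = plus (canonical_embedding x) (canonical_embedding y)).
{ intros x y. apply dual_ext. intros f. exact (dual_app_plus f x y). }
assert (Hcans : forall (a : scalars k) (x : Y), canonical_embedding (scal a x)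
  = scal a (canonical_embedding x)).
{ intros a x. apply dual_ext. intros f. exact (dual_app_scal f a x). }
assert (Hf0 : exists f0 : dual Y, dual_app F f0 = one /\
  forall y, In y l -> dual_app f0 y = zero).
{ apply NNPP. intros Hno.
  assert (H : exists y : Y, canonical_embedding y = F).
  { apply (@common_kernel (dual Y) (fun G => exists y : Y, canonical_embedding y = G)
      (map (@canonical_embedding k Y) l)).
    - split.
      + exists zero. apply dual_ext. exact dual_app_zero.
      + intros G H [x <-] [y <-]. exists (plus x y). apply Hcan.
      + intros a G [x <-]. exists (scal a x). apply Hcans.
    - intros G HG. apply in_map_iff in HG. destruct HG as [y [Hy _]]. exists y. exact Hy.
    - intros f Hf. apply NNPP. intros HFf.
      destruct (scalars_inv HFf) as [b [Hb _]].
      apply Hno. exists (scal b f). split.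
      + rewrite dual_app_scal. exact Hb.
      + intros y Hy. rewrite dual_scal_app.
        assert (H0 : dual_app f y = zero).
        { apply (Hf (canonical_embedding y)). apply in_map, Hy. }
        rewrite H0. sring. }
  destruct H as [y Hy]. specialize (HF (scal (opp one) y)).
  assert (H0 : plus F (canonical_embedding (scal (opp one) y)) = zero).
  { rewrite <- Hy. apply dual_ext. intros f.
    change (plus (dual_app f y) (dual_app f (scal (opp one) y)) = zero).
    rewrite dual_app_scal. sring. }
  rewrite H0, norm_zero in HF. lra. }
destruct Hf0 as [f0 [HFf0 Hf0]].
(* Only points [y] with [f0 y = 0] are admitted, as those in the span of [l] are. *)
set (P := fun G : dual (dual Y) => exists (a : scalars k) (y : Y), dual_app f0 y = zero /\
  G = plus (scal a F) (canonical_embedding y)).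
destruct (@helly (dual Y) P (F :: map (@canonical_embedding k Y) l) f0 (/ d))
  with (e := 1) as [f [Hf Hfl]].
- split.
  + exists zero, zero. split; [exact (dual_app_zero f0)|].
    apply dual_ext. intros f.
    change (zero = plus (mult zero (dual_app F f)) (dual_app f zero)).
    rewrite dual_app_zero. sring.
  + intros G H [a [x [Hx ->]]] [b [y [Hy ->]]]. exists (plus a b), (plus x y). split.
    * rewrite dual_app_plus, Hx, Hy. sring.
    * apply dual_ext. intros f.
      change (plus (plus (mult a (dual_app F f)) (dual_app f x))
        (plus (mult b (dual_app F f)) (dual_app f y))
        = plus (mult (plus a b) (dual_app F f)) (dual_app f (plus x y))).
      rewrite dual_app_plus. sring.
  + intros b G [a [x [Hx ->]]]. exists (mult b a), (scal b x). split.
    * rewrite dual_app_scal, Hx. sring.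
    * apply dual_ext. intros f.
      change (mult b (plus (mult a (dual_app F f)) (dual_app f x))
        = plus (mult (mult b a) (dual_app F f)) (dual_app f (scal b x))).
      rewrite dual_app_scal. sring.
- intros G [<-|HG].
  + exists one, zero. split; [exact (dual_app_zero f0)|].
    apply dual_ext. intros f.
    change (dual_app F f = plus (mult one (dual_app F f)) (dual_app f zero)).
    rewrite dual_app_zero. sring.
  + apply in_map_iff in HG. destruct HG as [y [<- Hy]]. exists zero, y.
    split; [apply Hf0, Hy|]. apply dual_ext. intros f.
    change (dual_app f y = plus (mult zero (dual_app F f)) (dual_app f y)). sring.
- intros G [a [y [Hy ->]]] HG.
  assert (Hval : plus (mult a (dual_app F f0)) (dual_app f0 y) = a).
  { rewrite HFf0, Hy. sring. }
  eapply Rle_trans; [right; exact (f_equal abs Hval)|].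
  destruct (classic (a = zero)) as [->|Ha].
  + eapply Rle_trans; [right; exact abs_zero|]. left. apply Rinv_0_lt_compat, Hd.
  + destruct (scalars_inv Ha) as [b [Hb Hab]].
    specialize (HF (scal b y)).
    assert (H : norm (plus F (canonical_embedding (scal b y))) = abs b *
      norm (plus (scal a F) (canonical_embedding y))).
    { rewrite <- norm_scal_eq. apply f_equal. apply dual_ext. intros f.
      change (plus (dual_app F f) (dual_app f (scal b y))
        = mult b (plus (mult a (dual_app F f)) (dual_app f y))).
      rewrite dual_app_scal.
      replace (mult b (plus (mult a (dual_app F f)) (dual_app f y)))
        with (plus (mult (mult b a) (dual_app F f)) (mult b (dual_app f y))) by sring.
      rewrite Hb. sring. }
    rewrite H in HF. generalize (abs_ge_0 a) (abs_ge_0 b). intros Ha0 Hb0.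
    apply Rmult_le_reg_l with d; [exact Hd|]. rewrite Rinv_r by lra.
    rewrite <- Hab. apply Rmult_le_compat_r; [exact Ha0|].
    eapply Rle_trans; [exact HF|]. generalize (norm_ge_0 (plus (scal a F) (canonical_embedding y))).
    nra.
- lra.
- exists f. split; [exact Hf|]. split.
  + rewrite <- HFf0. apply (Hfl F). left. reflexivity.
  + intros y Hy. rewrite <- (Hf0 y Hy). apply (Hfl (canonical_embedding y)).
    right. apply in_map, Hy.
Qed.

(** The sequences are chosen alternately: [f_n] vanishes at [e] and at the earlier
    points with [F f_n = 1], then [x_n] imitates [F] on [h, f_0, ..., f_n].
    If such a system exists the space is indeed not reflexive: a weak limit
    point [x] of [x_n] would satisfy [f_n x = 1] for all [n], and lie in the
    closed span of the [x_j], on which [f_n] tends to 0. *)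
Lemma triangular_system (Y : CompleteNormedModule (scalars k)) :
  ~ reflexive Y ->
  exists (C : R) (e : Y) (h : dual Y) (f : nat -> dual Y) (x : nat -> Y),
    0 < C /\ dual_app h e = one /\
    (forall n, norm (f n) <= C) /\ (forall n, norm (x n) <= C) /\
    (forall n, dual_app (f n) e = zero) /\ (forall n, dual_app h (x n) = zero) /\
    (forall i n, (i <= n)%nat -> dual_app (f i) (x n) = one) /\
    (forall j n, (j < n)%nat -> dual_app (f n) (x j) = zero).
Proof.
intros Hrefl.
assert (HF0 : exists F0 : dual (dual Y), forall y : Y, canonical_embedding y <> F0).
{ apply NNPP. intros Hno. apply Hrefl. intros F0. apply NNPP. intros HF0.
  apply Hno. exists F0. intros y Hy. apply HF0. exists y. exact Hy. }
destruct HF0 as [F0 HF0].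
assert (Hh : exists h : dual Y, dual_app F0 h <> zero).
{ apply NNPP. intros Hno. apply (HF0 zero). apply dual_ext. intros h.
  transitivity (zero : scalars k); [exact (dual_app_zero h)|].
  symmetry. apply NNPP. intros H. apply Hno. exists h. exact H. }
destruct Hh as [h Hh].
assert (He : exists e0 : Y, dual_app h e0 <> zero).
{ apply NNPP. intros Hno. apply Hh. replace h with (zero : dual Y).
  - exact (dual_app_zero F0).
  - apply dual_ext. intros y. symmetry. apply NNPP. intros H. apply Hno.
    exists y. exact H. }
destruct He as [e0 He0]. destruct (scalars_inv He0) as [b [Hb _]].
set (e := scal b e0 : Y).
assert (Hhe : dual_app h e = one).
{ transitivity (mult b (dual_app h e0)); [exact (dual_app_scal h b e0) | exact Hb]. }
(* Subtracting a point of [Y] from [F0] makes it vanish at [h]. *)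
set (F := plus F0 (canonical_embedding (scal (opp (dual_app F0 h)) e)) : dual (dual Y)).
assert (HFapp : forall g : dual Y, dual_app F g =
  plus (dual_app F0 g) (mult (opp (dual_app F0 h)) (dual_app g e))).
{ intros g. transitivity (plus (dual_app F0 g) (dual_app g (scal (opp (dual_app F0 h)) e)));
    [reflexivity|]. apply f_equal. exact (dual_app_scal g _ e). }
assert (HFh : dual_app F h = zero).
{ rewrite HFapp, Hhe. sring. }
assert (HF : forall y : Y, canonical_embedding y <> F).
{ intros y Hy. apply (HF0 (plus y (scal (dual_app F0 h) e))). apply dual_ext. intros g.
  transitivity (plus (dual_app g y) (mult (dual_app F0 h) (dual_app g e))).
  - transitivity (plus (dual_app g y) (dual_app g (scal (dual_app F0 h) e)));
      [exact (dual_app_plus g y _)|]. apply f_equal. exact (dual_app_scal g _ e).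
  - assert (Hg : dual_app g y = dual_app F g) by (rewrite <- Hy; reflexivity).
    rewrite Hg, HFapp. sring. }
destruct (bidual_distance HF) as [d [Hd Hdist]].
destruct (functional_choice _ (annihilating_functional Hd Hdist)) as [phi Hphi].
destruct (functional_choice _ (helly_bidual F)) as [xi Hxi].
set (state := fix state n : list Y * list (dual Y) :=
  match n with
  | O => (e :: nil, h :: nil)
  | S m => let g := phi (fst (state m)) :: snd (state m) in
           (xi g :: fst (state m), g)
  end).
set (f := fun n => phi (fst (state n))).
set (x := fun n => xi (snd (state (S n))) : Y).
assert (Hle : forall j n, (j < n)%nat -> In (x j) (fst (state n)) /\ In (f j) (snd (state n))).
{ intros j n Hjn. induction Hjn as [|n Hjn [IH1 IH2]].
  - split; left; reflexivity.
  - split; right; assumption. }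
assert (H0 : forall n, In e (fst (state n)) /\ In h (snd (state n))).
{ induction n as [|n [IH1 IH2]]; split; [left | left | right | right]; auto. }
exists (Rmax (/ d + 1) (norm F + 1)), e, h, f, x.
split; [|split; [exact Hhe|split; [|split; [|split; [|split; [|split]]]]]].
- eapply Rlt_le_trans; [|apply Rmax_r]. generalize (norm_ge_0 F). lra.
- intros n. eapply Rle_trans; [apply Hphi | apply Rmax_l].
- intros n. eapply Rle_trans; [apply Hxi | apply Rmax_r].
- intros n. apply (proj2 (proj2 (Hphi _))). apply H0.
- intros n. rewrite <- HFh. apply (proj2 (Hxi _)). apply H0.
- intros i n Hin. transitivity (dual_app F (f i)).
  + apply (proj2 (Hxi _)). apply Hle. lia.
  + apply (proj1 (proj2 (Hphi _))).
- intros j n Hjn. apply (proj2 (proj2 (Hphi _))). apply Hle, Hjn.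
Qed.

(** * A geometric obstruction to the FR-property *)

Lemma sum_two_extremal (a b : scalars k) (r : R) :
  abs a <= 1 -> abs b <= 1 -> 2 <= r -> plus a b = of_real k r -> a = one /\ b = one.
Proof.
intros Ha Hb Hr Hab.
assert (Hre : real_part a + real_part b = r).
{ rewrite <- real_part_plus, Hab. apply real_part_of_real. }
generalize (real_part_le_abs a) (real_part_le_abs b). intros Ha' Hb'. rewrite <- of_real_1.
split; apply real_part_ge_abs; lra.
Qed.

Lemma closed_singleton_zero : closed (fun c : scalars k => c = zero).
Proof.
intros c Hc. apply NNPP. intros Hc0. apply Hc.
assert (Hpos : 0 < abs c).
{ destruct (abs_ge_0 c) as [H|H]; [exact H|]. destruct Hc0.
  apply abs_eq_zero. symmetry. exact H. }
exists (mkposreal _ Hpos). intros y Hy Hy0. rewrite Hy0 in Hy.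
assert (H : abs (minus zero c) < abs c) by exact Hy.
assert (H' : minus zero c = opp c :> scalars k) by exact (plus_zero_l (opp c)).
rewrite H', abs_opp_eq in H. exact (Rlt_irrefl _ H).
Qed.

(** The operator that violates the property is [T x = f(x) e]. At [x] on the
    sphere the maximum equals 1 for small [s], so that functionals supporting
    the ball at [x] kill [e]; for [s = f x] it is at least [2 |f x|], which
    comes as close to 2 as desired. *)
Theorem FR_obstruction (Z : CompleteNormedModule (scalars k))
    (X : closed_subspace Z) (e : Z) (f : dual Z) :
  (forall x s, subspace_set X x ->
     norm (plus x (scal s e)) = Rmax (norm x) (abs (dual_app f x) + abs s)) ->
  (forall x, subspace_set X x -> norm x = 1 -> abs (dual_app f x) < 1) ->
  (forall eps, 0 < eps ->
     exists x, subspace_set X x /\ norm x = 1 /\ 1 - eps < abs (dual_app f x)) ->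
  ~ FR_property Z.
Proof.
intros Hnorm Hlt Hsup HFR.
assert (He : norm e = 1).
{ transitivity (norm (plus zero (scal one e))).
  - apply (f_equal norm). symmetry.
    transitivity (scal one e); [exact (plus_zero_l _) | exact (scal_one e)].
  - eapply eq_trans; [exact (Hnorm zero one (submodule_zero (subspace_submodule X)))|].
    assert (H : abs (dual_app f zero) = 0) by (rewrite dual_app_zero; exact abs_zero).
    eapply eq_trans;
      [exact (f_equal2 Rmax (norm_zero (V := Z)) (f_equal2 Rplus H abs_scalars_1))|].
    rewrite Rmax_right; lra. }
set (T := fun x : subspace X => scal (dual_app f (inclusion x)) e).
assert (HT : is_linear T).
{ split.
  - intros x y. transitivity (scal (plus (dual_app f (inclusion x)) (dual_app f (inclusion y))) e).
    + apply (f_equal (fun c => scal c e)). exact (dual_app_plus f (inclusion x) (inclusion y)).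
    + exact (scal_distr_r _ _ e).
  - intros a x. transitivity (scal (mult a (dual_app f (inclusion x))) e).
    + apply (f_equal (fun c => scal c e)). exact (dual_app_scal f a (inclusion x)).
    + symmetry. exact (scal_assoc a _ e).
  - exists (norm f + 1). generalize (norm_ge_0 f). intros Hf. split; [lra|].
    intros x. eapply Rle_trans; [right; exact (norm_scal_eq (dual_app f (inclusion x)) e)|].
    rewrite He, Rmult_1_r.
    apply Rle_trans with (norm f * norm x); [exact (dual_app_bound f (inclusion x))|].
    generalize (norm_ge_0 x). nra. }
destruct (HFR X T HT one) as [_ HV].
assert (HW : forall c, spatial_range (restrict HT) c -> c = zero).
{ intros c [[[[x HXx] Hx] [g Hg]] [[_ Hgx] ->]].
  change (dual_app g (scal (dual_app f x) e) = zero).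
  change (dual_app g x = one) in Hgx. change (norm x = 1) in Hx. change (norm g = 1) in Hg.
  (* The norm of [x + s e] stays 1 for [|s| <= t]; the phase of [s] is chosen
     to make [s * g e] nonnegative. *)
  assert (Hge : dual_app g e = zero).
  { destruct (phase (dual_app g e)) as [w [Hw Hwe]].
    set (t := 1 - abs (dual_app f x)).
    assert (Ht : 0 < t) by (generalize (Hlt x HXx Hx); unfold t; lra).
    assert (H : norm (plus x (scal (mult (of_real k t) w) e)) <= 1).
    { rewrite (Hnorm x _ HXx), abs_mult_eq, abs_real, Hw, (Rabs_pos_eq t), Hx by lra.
      unfold t. rewrite Rmax_left; lra. }
    assert (H' : abs (dual_app g (plus x (scal (mult (of_real k t) w) e))) <= 1).
    { eapply Rle_trans; [apply dual_app_bound|].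
      rewrite Hg, Rmult_1_l. exact H. }
    assert (H'' : dual_app g (plus x (scal (mult (of_real k t) w) e))
      = of_real k (1 + t * abs (dual_app g e))).
    { transitivity (plus (dual_app g x) (mult (mult (of_real k t) w) (dual_app g e))).
      - transitivity (plus (dual_app g x) (dual_app g (scal (mult (of_real k t) w) e)));
          [exact (dual_app_plus g x _) | apply f_equal; exact (dual_app_scal g _ e)].
      - rewrite of_real_plus, of_real_mult, <- Hwe, of_real_1, Hgx. sring. }
    rewrite H'', abs_real in H'. generalize (Rle_abs (1 + t * abs (dual_app g e))).
    intros Habs. apply abs_eq_zero. generalize (abs_ge_0 (dual_app g e)). intros H0.
    nra. }
  transitivity (mult (dual_app f x) (dual_app g e)); [exact (dual_app_scal g _ e)|].
  rewrite Hge. sring. }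
assert (H1 : intrinsic_range (restrict HT) one).
{ set (J := restrict (inclusion_is_linear X)).
  destruct (norming_functional (plus J (restrict HT))) as [Phi [HPhi HJT]].
  assert (HJ : norm J <= 1).
  { apply sup_norm_le; [lra|]. intros [x Hx]. right. exact Hx. }
  assert (HTn : norm (restrict HT) <= 1).
  { apply sup_norm_le; [lra|]. intros [[x HXx] Hx]. change (norm x = 1) in Hx.
    eapply Rle_trans; [right; exact (norm_scal_eq (dual_app f x) e)|].
    rewrite He, Rmult_1_r. left. apply Hlt; assumption. }
  assert (H2 : 2 <= norm (plus J (restrict HT))).
  { apply Rnot_lt_le. set (r := norm _). intros Hr.
    destruct (Hsup (1 - r / 2)) as [x [HXx [Hx Hfx]]]; [lra|].
    set (s := exist _ (exist _ x HXx : subspace X) Hx : sphere (subspace X)).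
    assert (Hs : norm (plus x (scal (dual_app f x) e)) <= r).
    { exact (sup_norm_ub (plus J (restrict HT)) s). }
    rewrite (Hnorm x _ HXx) in Hs.
    generalize (Rmax_r (norm x) (abs (dual_app f x) + abs (dual_app f x))). lra. }
  assert (Hb : forall u : bounded_on_sphere X, norm u <= 1 -> abs (dual_app Phi u) <= 1).
  { intros u Hu. eapply Rle_trans; [apply dual_app_bound|].
    generalize (norm_ge_0 u) (norm_ge_0 Phi). nra. }
  destruct (@sum_two_extremal (dual_app Phi J) (dual_app Phi (restrict HT))
    (norm (plus J (restrict HT)))) as [HPJ HPT]; auto.
  { rewrite <- HJT. symmetry. exact (dual_app_plus Phi J (restrict HT)). }
  exists Phi. split; [split|].
  - apply Rle_antisym; [exact HPhi|].
    generalize (dual_app_bound Phi J). rewrite HPJ.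
    rewrite abs_scalars_1.
    generalize (norm_ge_0 J) (norm_ge_0 Phi). nra.
  - exact HPJ.
  - symmetry. exact HPT. }
specialize (HV H1 (fun c => c = zero)).
assert (H10 : one = zero :> scalars k).
{ apply HV; [|exact closed_singleton_zero|exact HW].
  intros a b t -> -> _. sring. }
generalize (abs_scalars_1 (k := k)).
rewrite H10, abs_scalars_0. lra.
Qed.

(** * The renorming *)

Section Renorming.

Context {Y : NormedModule (scalars k)} (C : R) (e : Y) (h : dual Y)
  (f : nat -> dual Y).
Context (HC : 0 < C) (Hhe : dual_app h e = one) (Hf : forall n, norm (f n) <= C)
  (Hfe : forall n, dual_app (f n) e = zero).

(** The weights [1 / (n + 1)] tend to 0, which makes [deviation (x m)] small
    although [f_0 - f_n] takes the value 1 at [x m] for every [n > m]. *)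
Definition deviation_at (n : nat) (y : Y) : R :=
  abs (plus (dual_app (f 0%nat) y) (opp (dual_app (f n) y))) / (INR n + 1).

Definition deviation (y : Y) : R :=
  sup (fun r => exists n, r = deviation_at n y).

(** The projection onto the kernel of [h] along [e]. *)
Definition project (y : Y) : Y := plus y (scal (opp (dual_app h y)) e).

Definition new_norm (y : Y) : R :=
  Rmax (abs (dual_app (f 0%nat) y) + Rmax (deviation y) (abs (dual_app h y)))
    (norm (project y) / C).

Lemma abs_f_le n y : abs (dual_app (f n) y) <= C * norm y.
Proof.
eapply Rle_trans; [apply dual_app_bound|].
apply Rmult_le_compat_r; [apply norm_ge_0 | apply Hf].
Qed.

Lemma INR_1_pos n : 0 < / (INR n + 1) <= 1.
Proof.
generalize (pos_INR n). intros Hn. split; [apply Rinv_0_lt_compat; lra|].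
rewrite <- Rinv_1 at 2. apply Rinv_le_contravar; lra.
Qed.

Lemma deviation_at_ge_0 n y : 0 <= deviation_at n y.
Proof.
apply Rmult_le_pos; [apply abs_ge_0 | left; apply INR_1_pos].
Qed.

Lemma deviation_at_le n y : deviation_at n y <= 2 * C * norm y.
Proof.
unfold deviation_at, Rdiv. generalize (INR_1_pos n). intros Hn.
assert (H : abs (plus (dual_app (f 0%nat) y) (opp (dual_app (f n) y))) <= 2 * C * norm y).
{ eapply Rle_trans; [apply abs_triangle|]. rewrite abs_opp_eq.
  generalize (abs_f_le 0 y) (abs_f_le n y). lra. }
assert (H0 : 0 <= 2 * C * norm y) by (generalize (norm_ge_0 y); nra).
apply Rle_trans with (2 * C * norm y * / (INR n + 1)).
- apply Rmult_le_compat_r; lra.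
- rewrite <- (Rmult_1_r (2 * C * norm y)) at 2. apply Rmult_le_compat_l; lra.
Qed.

Lemma deviation_ub n y : deviation_at n y <= deviation y.
Proof.
apply sup_ub with (2 * C * norm y).
- intros r [m ->]. apply deviation_at_le.
- exists n. reflexivity.
Qed.

Lemma deviation_le y M : 0 <= M -> (forall n, deviation_at n y <= M) -> deviation y <= M.
Proof. intros HM H. apply sup_le; [exact HM|]. intros r [n ->]. apply H. Qed.

Lemma deviation_ge_0 y : 0 <= deviation y.
Proof. apply sup_ge_0. intros r [n ->]. apply deviation_at_ge_0. Qed.

Lemma project_plus x y : project (plus x y) = plus (project x) (project y).
Proof.
transitivity (plus (plus x y) (plus (scal (opp (dual_app h x)) e) (scal (opp (dual_app h y)) e))).
- apply (f_equal (plus (plus x y))).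
  transitivity (scal (plus (opp (dual_app h x)) (opp (dual_app h y))) e);
    [|exact (scal_distr_r _ _ e)].
  apply (f_equal (fun c => scal c e)).
  transitivity (opp (plus (dual_app h x) (dual_app h y)));
    [apply (f_equal opp); exact (dual_app_plus h x y) | sring].
- exact (vplusACA x y (scal (opp (dual_app h x)) e) (scal (opp (dual_app h y)) e)).
Qed.

Lemma project_scal a x : project (scal a x) = scal a (project x).
Proof.
transitivity (plus (scal a x) (scal a (scal (opp (dual_app h x)) e))).
- apply (f_equal (plus (scal a x))).
  transitivity (scal (mult a (opp (dual_app h x))) e); [|symmetry; exact (scal_assoc a _ e)].
  apply (f_equal (fun c => scal c e)).
  transitivity (opp (mult a (dual_app h x)));
    [apply (f_equal opp); exact (dual_app_scal h a x) | sring].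
- symmetry. exact (scal_distr_l a x _).
Qed.

Lemma project_id x : dual_app h x = zero -> project x = x.
Proof.
intros Hx. unfold project. rewrite Hx.
transitivity (plus x zero); [|exact (plus_zero_r x)]. apply (f_equal (plus x)).
transitivity (scal (zero : scalars k) e); [|exact (scal_zero_l e)].
apply (f_equal (fun c => scal c e)). sring.
Qed.

Lemma project_norm_le y : norm (project y) <= (1 + norm h * norm e) * norm y.
Proof.
eapply Rle_trans; [exact (norm_triangle y (scal (opp (dual_app h y)) e))|].
assert (H : norm (scal (opp (dual_app h y)) e) = abs (dual_app h y) * norm e).
{ transitivity (abs (opp (dual_app h y)) * norm e); [exact (norm_scal_eq _ e)|].
  rewrite abs_opp_eq. reflexivity. }
eapply Rle_trans; [apply Rplus_le_compat_l; right; exact H|].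
generalize (dual_app_bound h y). intros Hh.
apply Rmult_le_compat_r with (r := norm e) in Hh; [lra | apply norm_ge_0].
Qed.

Lemma norm_le_project y : norm y <= norm (project y) + abs (dual_app h y) * norm e.
Proof.
assert (H : y = plus (project y) (scal (dual_app h y) e)).
{ transitivity (plus y (plus (scal (opp (dual_app h y)) e) (scal (dual_app h y) e)));
    [|exact (plus_assoc y _ _)].
  symmetry. transitivity (plus y zero); [|exact (plus_zero_r y)].
  apply (f_equal (plus y)).
  transitivity (scal (plus (opp (dual_app h y)) (dual_app h y)) e);
    [symmetry; exact (scal_distr_r _ _ e)|].
  transitivity (scal (zero : scalars k) e); [|exact (scal_zero_l e)].
  apply (f_equal (fun c => scal c e)). sring. }
apply Rle_trans with (norm (plus (project y) (scal (dual_app h y) e))).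
- right. apply (f_equal norm). exact H.
- eapply Rle_trans; [exact (norm_triangle (project y) _)|].
  apply Rplus_le_compat_l. right. exact (norm_scal_eq _ e).
Qed.

Lemma new_norm_ge_f y : abs (dual_app (f 0%nat) y) <= new_norm y.
Proof.
eapply Rle_trans; [|apply Rmax_l].
generalize (Rmax_l (deviation y) (abs (dual_app h y))) (deviation_ge_0 y). lra.
Qed.

Lemma new_norm_ge_h y : abs (dual_app h y) <= new_norm y.
Proof.
eapply Rle_trans; [|apply Rmax_l].
generalize (Rmax_r (deviation y) (abs (dual_app h y))) (abs_ge_0 (dual_app (f 0%nat) y)). lra.
Qed.

Lemma new_norm_ge_project y : norm (project y) <= C * new_norm y.
Proof.
assert (H : norm (project y) / C <= new_norm y) by apply Rmax_r.
apply Rmult_le_compat_l with (r := C) in H; [|lra].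
replace (C * (norm (project y) / C)) with (norm (project y)) in H by (field; lra). exact H.
Qed.

Lemma new_norm_ge y : norm y <= (C + norm e) * new_norm y.
Proof.
eapply Rle_trans; [apply norm_le_project|].
generalize (new_norm_ge_project y) (new_norm_ge_h y) (norm_ge_0 e). nra.
Qed.

Lemma deviation_plus x y : deviation (plus x y) <= deviation x + deviation y.
Proof.
apply deviation_le; [generalize (deviation_ge_0 x) (deviation_ge_0 y); lra|].
intros n. apply Rle_trans with (deviation_at n x + deviation_at n y).
- unfold deviation_at. unfold Rdiv. rewrite <- Rmult_plus_distr_r.
  apply Rmult_le_compat_r; [left; apply INR_1_pos|].
  rewrite !dual_app_plus. eapply Rle_trans; [|apply abs_triangle].
  right. apply f_equal. sring.
- apply Rplus_le_compat; apply deviation_ub.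
Qed.

Lemma deviation_scal a y : deviation (scal a y) <= abs a * deviation y.
Proof.
apply deviation_le; [apply Rmult_le_pos; [apply abs_ge_0 | apply deviation_ge_0]|].
intros n. apply Rle_trans with (abs a * deviation_at n y).
- unfold deviation_at. unfold Rdiv. rewrite <- Rmult_assoc.
  apply Rmult_le_compat_r; [left; apply INR_1_pos|].
  rewrite !dual_app_scal, <- abs_mult_eq. right. apply f_equal. sring.
- apply Rmult_le_compat_l; [apply abs_ge_0 | apply deviation_ub].
Qed.

Lemma new_norm_is_norm : is_norm new_norm.
Proof.
apply is_norm_of_le.
- change (forall x y : Y, new_norm (plus x y) <= new_norm x + new_norm y).
  intros x y. apply Rmax_lub.
  + apply Rle_trans with
      ((abs (dual_app (f 0%nat) x) + Rmax (deviation x) (abs (dual_app h x))) +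
       (abs (dual_app (f 0%nat) y) + Rmax (deviation y) (abs (dual_app h y)))).
    * assert (H1 : abs (dual_app (f 0%nat) (plus x y)) <=
        abs (dual_app (f 0%nat) x) + abs (dual_app (f 0%nat) y)).
      { rewrite dual_app_plus. apply abs_triangle. }
      assert (H2 : Rmax (deviation (plus x y)) (abs (dual_app h (plus x y))) <=
        Rmax (deviation x) (abs (dual_app h x)) + Rmax (deviation y) (abs (dual_app h y))).
      { apply Rmax_lub.
        - eapply Rle_trans; [apply deviation_plus|].
          apply Rplus_le_compat; apply Rmax_l.
        - rewrite dual_app_plus. eapply Rle_trans; [apply abs_triangle|].
          apply Rplus_le_compat; apply Rmax_r. }
      lra.
    * apply Rplus_le_compat; apply Rmax_l.
  + rewrite project_plus. apply Rle_trans with (norm (project x) / C + norm (project y) / C).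
    * unfold Rdiv. rewrite <- Rmult_plus_distr_r.
      apply Rmult_le_compat_r; [left; apply Rinv_0_lt_compat, HC|].
      exact (norm_triangle (project x) (project y)).
    * apply Rplus_le_compat; apply Rmax_r.
- change (forall (a : scalars k) (y : Y), new_norm (scal a y) <= abs a * new_norm y).
  intros a y. apply Rmax_lub.
  + apply Rle_trans with
      (abs a * (abs (dual_app (f 0%nat) y) + Rmax (deviation y) (abs (dual_app h y)))).
    * rewrite dual_app_scal, abs_mult_eq, Rmult_plus_distr_l. apply Rplus_le_compat_l.
      apply Rmax_lub.
      -- eapply Rle_trans; [apply deviation_scal|].
         apply Rmult_le_compat_l; [apply abs_ge_0 | apply Rmax_l].
      -- rewrite dual_app_scal, abs_mult_eq.
         apply Rmult_le_compat_l; [apply abs_ge_0 | apply Rmax_r].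
    * apply Rmult_le_compat_l; [apply abs_ge_0 | apply Rmax_l].
  + rewrite project_scal. apply Rle_trans with (abs a * (norm (project y) / C)).
    * unfold Rdiv. rewrite <- Rmult_assoc.
      apply Rmult_le_compat_r; [left; apply Rinv_0_lt_compat, HC|].
      exact (norm_scal a (project y)).
    * apply Rmult_le_compat_l; [apply abs_ge_0 | apply Rmax_r].
- intros y Hy. apply (norm_eq_zero (V := Y)). apply Rle_antisym; [|apply norm_ge_0].
  eapply Rle_trans; [exact (new_norm_ge y)|]. rewrite Hy. lra.
Qed.

Lemma new_norm_bounds :
  exists a b, 0 < a /\ 0 < b /\ forall y : Y, a * norm y <= new_norm y <= b * norm y.
Proof.
assert (Hpos : 0 < C + norm e) by (generalize (norm_ge_0 e); lra).
set (b := C + (2 * C + norm h) + (1 + norm h * norm e) / C).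
exists (/ (C + norm e)), b. split; [apply Rinv_0_lt_compat, Hpos|].
assert (Hhe0 : 0 <= (1 + norm h * norm e) / C).
{ apply Rmult_le_pos; [|left; apply Rinv_0_lt_compat, HC].
  generalize (norm_ge_0 h) (norm_ge_0 e). nra. }
split; [unfold b; generalize (norm_ge_0 h); lra|]. intros y. split.
- apply Rmult_le_reg_l with (C + norm e); [exact Hpos|].
  rewrite <- Rmult_assoc, Rinv_r, Rmult_1_l by lra. apply new_norm_ge.
- generalize (norm_ge_0 y) (norm_ge_0 h). intros Hy Hh. unfold b. apply Rmax_lub.
  + assert (H : Rmax (deviation y) (abs (dual_app h y)) <= (2 * C + norm h) * norm y).
    { apply Rmax_lub.
      - assert (H : 0 <= norm h * norm y) by (apply Rmult_le_pos; assumption).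
        apply deviation_le; [nra|]. intros n. generalize (deviation_at_le n y). lra.
      - generalize (dual_app_bound h y). nra. }
    generalize (abs_f_le 0 y). nra.
  + assert (H : norm (project y) / C <= (1 + norm h * norm e) / C * norm y).
    { generalize (project_norm_le y). intros H.
      apply Rmult_le_compat_r with (r := / C) in H; [|left; apply Rinv_0_lt_compat, HC].
      unfold Rdiv. lra. }
    nra.
Qed.

(** Neither the [f_n] nor the projection see [s e], so only [|h|] changes, from 0
    to [|s|]. *)
Lemma new_norm_add (x : Y) (s : scalars k) :
  dual_app h x = zero ->
  new_norm (plus x (scal s e)) =
    Rmax (new_norm x) (abs (dual_app (f 0%nat) x) + abs s).
Proof.
intros Hx.
assert (Hfs : forall n, dual_app (f n) (plus x (scal s e)) = dual_app (f n) x).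
{ intros n. transitivity (plus (dual_app (f n) x) (mult s (dual_app (f n) e))).
  - rewrite dual_app_plus. apply f_equal. exact (dual_app_scal (f n) s e).
  - rewrite Hfe. sring. }
assert (Hhs : dual_app h (plus x (scal s e)) = s).
{ transitivity (plus (dual_app h x) (mult s (dual_app h e))).
  - rewrite dual_app_plus. apply f_equal. exact (dual_app_scal h s e).
  - rewrite Hx, Hhe. sring. }
assert (Hd : deviation (plus x (scal s e)) = deviation x).
{ unfold deviation. apply (f_equal sup). apply functional_extensionality. intros r.
  unfold deviation_at.
  assert (H : (fun n => abs (plus (dual_app (f 0%nat) (plus x (scal s e)))
      (opp (dual_app (f n) (plus x (scal s e))))) / (INR n + 1)) =
    (fun n => abs (plus (dual_app (f 0%nat) x) (opp (dual_app (f n) x))) / (INR n + 1))).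
  { apply functional_extensionality. intros n. rewrite !Hfs. reflexivity. }
  exact (f_equal (fun u => exists n, r = u n) H). }
assert (Hp : project (plus x (scal s e)) = x).
{ transitivity (plus x (plus (scal s e) (scal (opp s) e))).
  - symmetry. transitivity (plus (plus x (scal s e)) (scal (opp s) e));
      [exact (plus_assoc x _ _)|].
    unfold project. rewrite Hhs. reflexivity.
  - transitivity (plus x zero); [|exact (plus_zero_r x)]. apply (f_equal (plus x)).
    transitivity (scal (plus s (opp s)) e); [symmetry; exact (scal_distr_r _ _ e)|].
    transitivity (scal (zero : scalars k) e); [|exact (scal_zero_l e)].
    apply (f_equal (fun c => scal c e)). sring. }
unfold new_norm. rewrite Hd, Hp, (project_id Hx), Hhs, Hfs, Hx.
rewrite abs_scalars_0, (Rmax_left (deviation x) 0) by apply deviation_ge_0.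
set (u := norm x / C). set (v := abs (dual_app (f 0%nat) x)).
unfold Rmax. destruct (Rle_dec (deviation x) (abs s)), (Rle_dec (v + deviation x) u);
repeat match goal with |- context [Rle_dec ?a ?b] => destruct (Rle_dec a b) end; lra.
Qed.

Definition vanishing_subspace_set (y : Y) : Prop :=
  dual_app h y = zero /\
  forall eps, 0 < eps -> exists n0, forall n, (n0 <= n)%nat -> abs (dual_app (f n) y) <= eps.

Lemma vanishing_submodule : is_submodule vanishing_subspace_set.
Proof.
split.
- split; [exact (dual_app_zero h)|]. intros eps Heps. exists 0%nat. intros n _.
  apply Rle_trans with (abs (zero : scalars k)); [|rewrite abs_scalars_0; lra].
  right. apply (f_equal abs). exact (dual_app_zero (f n)).
- change (forall x y : Y, vanishing_subspace_set x -> vanishing_subspace_set y ->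
    vanishing_subspace_set (plus x y)).
  intros x y [Hx1 Hx2] [Hy1 Hy2]. split.
  + rewrite dual_app_plus, Hx1, Hy1. sring.
  + intros eps Heps. destruct (Hx2 (eps / 2)) as [n1 H1]; [lra|].
    destruct (Hy2 (eps / 2)) as [n2 H2]; [lra|].
    exists (max n1 n2). intros n Hn. rewrite dual_app_plus.
    eapply Rle_trans; [apply abs_triangle|].
    generalize (H1 n ltac:(lia)) (H2 n ltac:(lia)). lra.
- change (forall (a : scalars k) (x : Y), vanishing_subspace_set x ->
    vanishing_subspace_set (scal a x)).
  intros a x [Hx1 Hx2]. split.
  + rewrite dual_app_scal, Hx1. sring.
  + intros eps Heps. generalize (abs_ge_0 a). intros Ha.
    assert (He : 0 < eps / (abs a + 1)) by (apply Rdiv_lt_0_compat; lra).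
    destruct (Hx2 _ He) as [n0 H]. exists n0. intros n Hn.
    rewrite dual_app_scal, abs_mult_eq.
    apply Rle_trans with (abs a * (eps / (abs a + 1))).
    * apply Rmult_le_compat_l; [exact Ha | apply H, Hn].
    * replace (abs a * (eps / (abs a + 1))) with (eps - eps / (abs a + 1)) by (field; lra).
      lra.
Qed.

Lemma functional_near (g : dual Y) (x y : Y) :
  abs (dual_app g x) <= abs (dual_app g y) + norm g * ((C + norm e) * new_norm (minus y x)).
Proof.
replace (dual_app g x) with (plus (dual_app g y) (opp (dual_app g (minus y x)))).
- eapply Rle_trans; [apply abs_triangle|]. apply Rplus_le_compat_l. rewrite abs_opp_eq.
  eapply Rle_trans; [apply dual_app_bound|].
  apply Rmult_le_compat_l; [apply norm_ge_0 | apply new_norm_ge].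
- rewrite dual_app_minus. sring.
Qed.

(** The form of closedness that speaks of [new_norm] without mentioning its
    topology; it holds because the [f_n] are uniformly bounded for
    [new_norm]. *)
Lemma vanishing_near (x : Y) :
  (forall d, 0 < d -> exists y : Y,
    vanishing_subspace_set y /\ new_norm (minus y x) < d) ->
  vanishing_subspace_set x.
Proof.
intros Hnear.
assert (Hpos : 0 < C + norm e) by (generalize (norm_ge_0 e); lra).
assert (Happrox : forall M eps, 0 <= M -> 0 < eps -> exists y : Y,
    vanishing_subspace_set y /\ M * ((C + norm e) * new_norm (minus y x)) <= eps).
{ intros M eps HM Heps.
  assert (Hd : 0 < eps / ((M + 1) * (C + norm e))).
  { apply Rdiv_lt_0_compat; [exact Heps|]. apply Rmult_lt_0_compat; lra. }
  destruct (Hnear _ Hd) as [y [Hy Hyx]]. exists y. split; [exact Hy|].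
  apply Rle_trans with (M * ((C + norm e) * (eps / ((M + 1) * (C + norm e))))).
  - apply Rmult_le_compat_l; [exact HM|]. apply Rmult_le_compat_l; lra.
  - replace (M * ((C + norm e) * (eps / ((M + 1) * (C + norm e)))))
      with (eps - eps / (M + 1)) by (field; lra).
    assert (0 < eps / (M + 1)) by (apply Rdiv_lt_0_compat; lra). lra. }
split.
- apply abs_eq_zero. apply Rle_antisym; [|apply abs_ge_0].
  apply Rnot_lt_le. intros Hlt.
  destruct (Happrox (norm h) (abs (dual_app h x) / 2) (norm_ge_0 h)) as [y [[Hy _] Hyx]];
    [lra|].
  generalize (functional_near h x y). rewrite Hy, abs_scalars_0. lra.
- intros eps Heps.
  destruct (Happrox C (eps / 2)) as [y [[_ Hy] Hyx]]; [lra | lra |].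
  destruct (Hy (eps / 2)) as [n0 Hn0]; [lra|]. exists n0. intros n Hn.
  eapply Rle_trans; [exact (functional_near (f n) x y)|].
  assert (H : norm (f n) * ((C + norm e) * new_norm (minus y x)) <=
    C * ((C + norm e) * new_norm (minus y x))).
  { apply Rmult_le_compat_r; [|apply Hf].
    apply Rmult_le_pos; [lra|]. exact (Rle_trans _ _ _ (abs_ge_0 _) (new_norm_ge_f (minus y x))). }
  generalize (Hn0 n Hn). lra.
Qed.

(** Attainment would leave no room for [deviation x], forcing [f_n x = f_0 x] for
    all [n], against [f_n x -> 0]. *)
Lemma not_attained (x : Y) :
  vanishing_subspace_set x -> new_norm x = 1 -> abs (dual_app (f 0%nat) x) < 1.
Proof.
intros [_ Hx] HN. apply Rnot_le_lt. intros Hge.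
assert (Hd : deviation x <= 0).
{ generalize (Rmax_l (abs (dual_app (f 0%nat) x) + Rmax (deviation x) (abs (dual_app h x)))
    (norm (project x) / C)) (Rmax_l (deviation x) (abs (dual_app h x))).
  change (Rmax _ (norm (project x) / C)) with (new_norm x). rewrite HN. lra. }
destruct (Hx (1 / 2)) as [n Hn]; [lra|]. specialize (Hn n (le_n n)).
generalize (Rle_trans _ _ _ (deviation_ub n x) Hd). unfold deviation_at. intros H.
assert (H0 : abs (plus (dual_app (f 0%nat) x) (opp (dual_app (f n) x))) <= 0).
{ apply Rmult_le_reg_r with (/ (INR n + 1)); [apply INR_1_pos|].
  rewrite Rmult_0_l. exact H. }
assert (H1 : abs (dual_app (f 0%nat) x) <= abs (dual_app (f n) x) +
   abs (plus (dual_app (f 0%nat) x) (opp (dual_app (f n) x)))).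
{ eapply Rle_trans; [|apply abs_triangle]. right. apply f_equal. sring. }
lra.
Qed.

(** The points are the normalized [x m]: there [f_0] is 1, the differences
    [f_0 - f_n] vanish for [n <= m] and have weight at most [1 / m] beyond. *)
Lemma almost_attained (x : nat -> Y) :
  (forall n, norm (x n) <= C) -> (forall n, dual_app h (x n) = zero) ->
  (forall i n, (i <= n)%nat -> dual_app (f i) (x n) = one) ->
  (forall j n, (j < n)%nat -> dual_app (f n) (x j) = zero) ->
  forall eps, 0 < eps -> exists y, vanishing_subspace_set y /\ new_norm y = 1 /\
    1 - eps < abs (dual_app (f 0%nat) y).
Proof.
intros Hx Hhx Hfx1 Hfx0 eps Heps.
destruct (archimed_cor1 eps Heps) as [m [Hm Hm0]].
set (y := x m).
assert (HyV : vanishing_subspace_set y).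
{ split; [apply Hhx|]. intros d Hd. exists (S m). intros n Hn. unfold y.
  rewrite (Hfx0 m n Hn), abs_scalars_0. lra. }
assert (Hfy : abs (dual_app (f 0%nat) y) = 1).
{ unfold y. rewrite (Hfx1 0%nat m (Nat.le_0_l m)). exact abs_one. }
assert (Hmpos : 0 < INR m) by (apply lt_0_INR, Hm0).
assert (Hd : deviation y <= / INR m).
{ apply deviation_le; [left; apply Rinv_0_lt_compat, Hmpos|]. intros n.
  unfold deviation_at, y. assert (H1 := Hfx1 0%nat m (Nat.le_0_l m)).
  destruct (Nat.le_gt_cases n m) as [Hnm|Hnm].
  - assert (H : plus (dual_app (f 0%nat) (x m)) (opp (dual_app (f n) (x m))) = zero).
    { rewrite H1, (Hfx1 n m Hnm). sring. }
    rewrite H, abs_scalars_0. unfold Rdiv. rewrite Rmult_0_l. left. apply Rinv_0_lt_compat, Hmpos.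
  - assert (H : plus (dual_app (f 0%nat) (x m)) (opp (dual_app (f n) (x m))) = one).
    { rewrite H1, (Hfx0 m n Hnm). sring. }
    rewrite H, abs_scalars_1. unfold Rdiv. rewrite Rmult_1_l.
    apply Rinv_le_contravar; [exact Hmpos|].
    apply lt_INR in Hnm. lra. }
assert (HN1 : 1 <= new_norm y) by (rewrite <- Hfy; apply new_norm_ge_f).
assert (HN2 : new_norm y <= 1 + / INR m).
{ apply Rmax_lub.
  - rewrite Hfy. apply Rplus_le_compat_l. apply Rmax_lub; [exact Hd|].
    unfold y. rewrite Hhx, abs_scalars_0. left. apply Rinv_0_lt_compat, Hmpos.
  - rewrite (project_id (x := y) (Hhx m)). apply Rle_trans with 1.
    + apply Rmult_le_reg_r with C; [exact HC|]. unfold Rdiv.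
      rewrite Rmult_assoc, Rinv_l by lra. rewrite Rmult_1_r, Rmult_1_l. apply Hx.
    + generalize (Rinv_0_lt_compat _ Hmpos). lra. }
set (t := / new_norm y).
assert (Ht : 0 < t) by (apply Rinv_0_lt_compat; lra).
exists (scal (of_real k t) y). split; [|split].
- exact (submodule_scal vanishing_submodule (of_real k t) HyV).
- transitivity (abs (of_real k t) * new_norm y);
    [exact (is_norm_scal new_norm_is_norm (of_real k t) y)|].
  rewrite abs_real, Rabs_pos_eq by lra. unfold t. field. lra.
- rewrite dual_app_scal, abs_mult_eq, Hfy, abs_real, Rabs_pos_eq, Rmult_1_r by lra.
  assert (Ht' : t * new_norm y = 1) by (unfold t; field; lra). nra.
Qed.

End Renorming.

Section RenormedSpace.

Context {Y : CompleteNormedModule (scalars k)} (C : R) (e : Y) (h : dual Y)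
  (f : nat -> dual Y).
Context (HC : 0 < C) (Hf : forall n, norm (f n) <= C).

Lemma new_norm_equivalent : equivalent_norm (new_norm C e h f).
Proof.
split; [exact (new_norm_is_norm e h HC Hf) | exact (new_norm_bounds e h HC Hf)].
Qed.

Lemma vanishing_closed :
  closed (vanishing_subspace_set h f : renorm new_norm_equivalent -> Prop).
Proof.
intros x Hx. apply (vanishing_near (e := e) HC Hf). intros d Hd.
apply NNPP. intros Hno. apply Hx. exists (mkposreal d Hd).
intros y Hy HyV. apply Hno. exists y. split; [exact HyV | exact Hy].
Qed.

Definition vanishing_subspace : closed_subspace (renorm new_norm_equivalent) :=
  {| subspace_set := (vanishing_subspace_set h f : renorm new_norm_equivalent -> Prop);
     subspace_submodule := vanishing_submodule h f;
     subspace_closed := vanishing_closed |}.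

End RenormedSpace.

End Functionals.

Theorem proposition3p3 (k : real_or_complex)
    (Y : CompleteNormedModule (scalars k)) :
  ~ reflexive Y ->
  exists (N : Y -> R) (HN : equivalent_norm N), ~ FR_property (renorm HN).
Proof.
intros Hrefl.
destruct (triangular_system Hrefl)
  as [C [e [h [f [x [HC [Hhe [Hf [Hx [Hfe [Hhx [Hf1 Hf0]]]]]]]]]]]].
exists (new_norm C e h f), (new_norm_equivalent e h HC Hf).
destruct (@dual_make k (renorm (new_norm_equivalent e h HC Hf)) (dual_app (f 0%nat)) 1)
  as [g [_ Hg]].
- lra.
- exact (dual_app_plus (f 0%nat)).
- exact (dual_app_scal (f 0%nat)).
- intros y. rewrite Rmult_1_l. exact (new_norm_ge_f C e h f y).
- apply (@FR_obstruction k _ (vanishing_subspace e h HC Hf) e g).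
  + intros y s [Hy _]. rewrite Hg. exact (new_norm_add C Hhe Hfe s Hy).
  + intros y Hy Hy1. rewrite Hg. exact (not_attained HC Hf Hy Hy1).
  + intros eps Heps.
    destruct (almost_attained e HC Hf Hx Hhx Hf1 Hf0 Heps) as [y [Hy [Hy1 Hye]]].
    exists y. split; [exact Hy|]. split; [exact Hy1|]. rewrite Hg. exact Hye.
Qed.
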